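(* Let $d\ge 2$ and let $K\subseteq\mathbb{R}^d$ be a $0$-symmetric convex body. (a) If $K$ is a polytope with $N$ non-parallel face directions and $0<\epsilon<\frac{1}{\sqrt{2}\,N}$, then there is no $\epsilon$-good probability measure supported on $\partial K$. (b) If $K$ is a polytope with $N$ non-parallel face directions, then for every $\delta>0$ there is a $\left(\frac1N+\delta\right)$-good probability measure supported on $\partial K$. If $K$ is not a polytope, then for every $\epsilon>0$ there is an $\epsilon$-good probability measure supported on $\partial K$.
   Context: A convex body $K$ is $0$-symmetric if $K=-K$. A $0$-symmetric polytope $K$ has $N$ non-parallel face directions if the set of unit outward normals to its $(d-1)$-dimensional faces (facets) consists of exactly $N$ distinct pairs $\pm\theta_1,\ldots,\pm\theta_N$; equivalently, $K$ has $N$ pairs of opposite facets. The Fourier transform of a finite measure $\mu$ on $\mathbb{R}^d$ is $\widehat{\mu}(\xi)=\int_{\mathbb{R}^d}e^{-2\pi i\langle x,\xi\rangle}\,d\mu(x)$. For $\eta>0$, a finite measure $\mu$ on $\mathbb{R}^d$ is called $\eta$-good if for some $R>0$ we have $|\widehat{\mu}(x)|\le\eta$ whenever $|x|\ge R$ (Euclidean norm). *)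

(* Defs.v *)
From mathcomp Require Export all_boot all_order all_algebra.
From mathcomp.real_closed Require Export complex.
From mathcomp Require Export all_classical all_reals all_analysis.
Export Order.TTheory GRing.Theory Num.Theory.
Export numFieldNormedType.Exports.

#[export] Set Implicit Arguments.
#[export] Unset Strict Implicit.
#[export] Unset Printing Implicit Defensive.

Local Open Scope classical_set_scope.
Local Open Scope ring_scope.

Definition dotp (R : realType) (d : nat) (x y : 'rV[R]_d) : R :=
  \sum_(i < d) x ord0 i * y ord0 i.

(* The library's norm on 'rV[R]_d is the sup norm, hence this definition; both
   norms induce the library's topology on 'rV[R]_d. *)
Definition enorm (R : realType) (d : nat) (x : 'rV[R]_d) : R :=
  Num.sqrt (dotp x x).

Definition boundary (T : topologicalType) (A : set T) : set T :=
  closure A `\` interior A.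

Definition convex_body (R : realType) (d : nat) (K : set 'rV[R]_d) : Prop :=
  [/\ convex_set K, compact K & interior K !=set0].

Definition zero_symmetric (R : realType) (d : nat) (K : set 'rV[R]_d) : Prop :=
  K = [set - x | x in K].

Definition convex_hull (R : realType) (d : nat) (A : set 'rV[R]_d) :
    set 'rV[R]_d :=
  smallest (fun B : set 'rV[R]_d => convex_set B) A.

Definition is_polytope (R : realType) (d : nat) (K : set 'rV[R]_d) : Prop :=
  exists s : seq 'rV[R]_d, K = convex_hull [set` s].

(* The subspace V is the direction of the affine hull of F: it is the span of
   the differences of points of F. *)
Definition has_affine_dim (R : realType) (d : nat) (F : set 'rV[R]_d)
    (k : nat) : Prop :=
  F !=set0 /\
  exists V : {vspace 'rV[R]_d},
    [/\ \dim V = k,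
        forall x y, F x -> F y -> x - y \in V &
        forall W : {vspace 'rV[R]_d},
          (forall x y, F x -> F y -> x - y \in W) -> (V <= W)%VS].

Definition is_face (R : realType) (d : nat) (K F : set 'rV[R]_d) : Prop :=
  exists (u : 'rV[R]_d) (c : R),
    (forall x, K x -> dotp u x <= c) /\ F = K `&` [set x | dotp u x = c].

Definition is_facet (R : realType) (d : nat) (K F : set 'rV[R]_d) : Prop :=
  is_face K F /\ has_affine_dim F d.-1.

Definition facet_normals (R : realType) (d : nat) (K : set 'rV[R]_d) :
    set 'rV[R]_d :=
  [set u | enorm u = 1 /\ exists F : set 'rV[R]_d, is_facet K F /\
     forall x y, F x -> K y -> dotp u y <= dotp u x].

Definition has_face_directions (R : realType) (d : nat) (K : set 'rV[R]_d)
    (N : nat) : Prop :=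
  exists theta : 'I_N -> 'rV[R]_d,
    (forall i j, i != j -> theta i <> theta j /\ theta i <> - theta j) /\
    facet_normals K = [set u | exists i, u = theta i \/ u = - theta i].

Definition borelRV (R : realType) (d : nat) :=
  g_sigma_algebraType (@open 'rV[R]_d).

(* e^(i t) *)
Definition expi (R : realType) (t : R) : R[i] := Complex (cos t) (sin t).

Definition cintegral (disp : measure_display) (T : measurableType disp)
    (R : realType) (mu : {measure set T -> \bar R}) (f : T -> R[i]) : R[i] :=
  Complex (\int[mu]_x complex.Re (f x)) (\int[mu]_x complex.Im (f x)).

Definition fourier (R : realType) (d : nat)
    (mu : {finite_measure set (borelRV R d) -> \bar R}) (xi : 'rV[R]_d) : R[i] :=
  cintegral mu (fun x : 'rV[R]_d => expi (- (2 * pi * dotp x xi))).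

Definition good (R : realType) (d : nat) (eta : R)
    (mu : {finite_measure set (borelRV R d) -> \bar R}) : Prop :=
  exists2 r : R, 0 < r &
    forall x : 'rV[R]_d, r <= enorm x -> `|fourier mu x| <= (eta%:C)%C.

(* For closed A this says that A contains the topological support of mu. *)
Definition supported_on (R : realType) (d : nat)
    (mu : {finite_measure set (borelRV R d) -> \bar R})
    (A : set 'rV[R]_d) : Prop :=
  mu (~` A) = 0%E.

(* Main.v *)
From HB Require Import structures.
Require Import Defs.
From mathcomp Require Import measurable_realfun ring lra.

Local Open Scope classical_set_scope.
Local Open Scope ring_scope.

(** Lower bound: the boundary of a polytope lies on [N] pairs of hyperplanes
    [<theta_i, x> = +- c_i], one of which carries mass at least [1/N].  By Wiener's
    lemma the squared modulus of the transform along [theta_i] averages to at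
    least [a^2 + b^2 >= 1/(2 N^2)], where [a], [b] are the masses of the two
    hyperplanes.

    Upper bound: if the boundary is almost flat near [N] points, with pairwise
    non-parallel normals [q_i], put on it short nearly straight curves, [m] for
    each [q_i], with directions orthogonal to [q_i] and otherwise in general
    position.  The transform of arc measure on a curve of direction [v] decays
    uniformly on the set [|<v, xi>| >= c |xi|], and every [xi] violates this for
    at most [m + N d] of the [N m] curves, because it is nearly parallel to at
    most one [q_i].  Averaging gives [1/N + d/m] up to a small error.

    Almost flat pieces: the gauge of [K] is strictly differentiable on a dense
    set (Baire), and its gradients [q] at such points determine [K] as the set
    where all [<q, y> <= 1].  If they were finite in number, [K] would be a bounded
    polyhedron, hence a polytope; for a polytope they are normal to facets. *)

(** Arcs are used instead of surface measure because no smoothness of the boundary is available, and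
    a curve only has to be Lipschitz-close to a segment. The resulting bound on its transform has
    one part that vanishes at infinity and one constant part, proportional to the ratio of the
    Lipschitz error to [c]. Goodness asks only for a fixed bound outside a ball, so a small constant
    part is harmless. The choices do not run in a circle: the directions depend on the [q_i] and
    [m], [c] on the directions, the admissible error on [c]; only then are the curves taken, and
    last the radius. Differentiability at a point compares other points with that point alone,
    whereas Lipschitz closeness to a segment compares all pairs of points of the curve. This forces
    strict differentiability and hence the Baire argument, for which completeness is declared
    here. *)

HB.instance Definition _ (R : realType) (m n : nat) :=
  Uniform_isComplete.Build 'M[R]_(m, n) cauchy_cvg.

Lemma lipschitz_continuous (R : realType) (V W : normedModType R) (f : V -> W)
    (k : R) :
  0 <= k -> (forall x y, `|f x - f y| <= k * `|x - y|) -> continuous f.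
Proof.
move=> k0 h y; apply/cvgrPdist_lt => e e0.
have D0 : 0 < k + 1 by rewrite ltr_wpDl.
near=> z; apply: le_lt_trans (h _ _) _.
have : `|y - z| < e / (k + 1) by near: z; apply: cvgr_dist_lt; rewrite ?divr_gt0.
rewrite ltr_pdivlMr// mulrC; apply: le_lt_trans; rewrite ler_wpM2r// lerDl//.
Unshelve. all: by end_near. Qed.

Lemma closed_level_set (R : realType) (T : topologicalType) (f : T -> R) (c : R) :
  continuous f -> closed [set x | f x = c].
Proof.
move=> cf; apply: (@preimage_closed _ _ f [set x | x = c]).
  by move=> x _; exact: cf.
exact: closed_eq.
Qed.

(** * The Euclidean pairing and its comparison with the sup norm *)

Section dot_product.
Variables (R : realType) (d : nat).
Implicit Types (x y z : 'rV[R]_d) (a : R).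

Lemma dotpC x y : dotp x y = dotp y x.
Proof. by apply: eq_bigr => i _; rewrite mulrC. Qed.

Lemma dotpDr x y z : dotp x (y + z) = dotp x y + dotp x z.
Proof. by rewrite -big_split; apply: eq_bigr => i _; rewrite mxE mulrDr. Qed.

Lemma dotpZr a x y : dotp x (a *: y) = a * dotp x y.
Proof. by rewrite big_distrr; apply: eq_bigr => i _; rewrite mxE mulrCA. Qed.

Lemma dotpNr x y : dotp x (- y) = - dotp x y.
Proof. by rewrite -scaleN1r dotpZr mulN1r. Qed.

Lemma dotpBr x y z : dotp x (y - z) = dotp x y - dotp x z.
Proof. by rewrite dotpDr dotpNr. Qed.

Lemma dotp0r x : dotp x 0 = 0.
Proof. by rewrite -(scale0r 0) dotpZr mul0r. Qed.

Lemma dotpDl x y z : dotp (x + y) z = dotp x z + dotp y z.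
Proof. by rewrite dotpC dotpDr !(dotpC z). Qed.

Lemma dotpZl a x y : dotp (a *: x) y = a * dotp x y.
Proof. by rewrite dotpC dotpZr dotpC. Qed.

Lemma dotpNl x y : dotp (- x) y = - dotp x y.
Proof. by rewrite dotpC dotpNr dotpC. Qed.

Lemma dotpBl x y z : dotp (x - y) z = dotp x z - dotp y z.
Proof. by rewrite dotpDl dotpNl. Qed.

Lemma dotp0l x : dotp 0 x = 0.
Proof. by rewrite dotpC dotp0r. Qed.

Lemma dotpxx_ge0 x : 0 <= dotp x x.
Proof. by apply: sumr_ge0 => i _; rewrite -expr2 sqr_ge0. Qed.

Lemma dotpxx_eq0 x : (dotp x x == 0) = (x == 0).
Proof.
apply/eqP/eqP => [|->]; last by rewrite dotp0l.
move=> /eqP; rewrite psumr_eq0 => [/allP h|i _]; last by rewrite -expr2 sqr_ge0.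
apply/rowP => i; rewrite mxE; apply/eqP.
by have := h i (mem_index_enum _); rewrite /= mulf_eq0 orbb.
Qed.

Lemma dotpxx_gt0 x : (0 < dotp x x) = (x != 0).
Proof. by rewrite lt_def dotpxx_ge0 andbT dotpxx_eq0. Qed.

Lemma coord_le_norm x i : `|x ord0 i| <= `|x|.
Proof.
rewrite [leRHS]/Num.norm /= mx_normrE; apply/bigmax_geP; right => /=.
by exists (ord0, i).
Qed.

Lemma norm_le_coord x a : 0 <= a -> (forall i, `|x ord0 i| <= a) -> `|x| <= a.
Proof.
move=> a0 h; rewrite [leLHS]/Num.norm /= mx_normrE; apply/bigmax_leP; split => //.
by case=> i j _ /=; rewrite ord1.
Qed.

Lemma normr_dotp x y : `|dotp x y| <= d%:R * `|x| * `|y|.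
Proof.
apply: le_trans (ler_norm_sum _ _ _) _.
rewrite -mulrA -[d in d%:R]card_ord -sum1_card natr_sum mulr_suml.
apply: ler_sum => i _; rewrite mul1r normrM.
by apply: ler_pM => //; exact: coord_le_norm.
Qed.

Lemma enorm_le x : enorm x <= d%:R * `|x|.
Proof.
rewrite /enorm -[leRHS]ger0_norm; last by rewrite mulr_ge0.
rewrite -sqrtr_sqr ler_sqrt ?sqr_ge0//.
apply: le_trans (ler_norm _) _; apply: le_trans (normr_dotp _ _) _.
rewrite -mulrA exprMn ler_wpM2r ?mulr_ge0 ?sqr_ge0 ?expr2//.
by rewrite -natrM ler_nat; case: (d) => // n; rewrite leq_pmulr.
Qed.

Lemma enorm_eq1 x : (enorm x == 1) = (dotp x x == 1).
Proof.
rewrite /enorm; apply/eqP/eqP => [h|->]; last exact: sqrtr1.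
by rewrite -[LHS]sqr_sqrtr ?dotpxx_ge0// h expr1n.
Qed.

Lemma enormZ a x : enorm (a *: x) = `|a| * enorm x.
Proof.
by rewrite /enorm dotpZl dotpZr mulrA -expr2 sqrtrM ?sqr_ge0// sqrtr_sqr.
Qed.

Lemma dotp_continuous x : continuous (dotp x).
Proof.
apply: (@lipschitz_continuous _ _ _ _ (d%:R * `|x|)); first by rewrite mulr_ge0.
by move=> y z; rewrite -dotpBr; exact: normr_dotp.
Qed.

Lemma dotp_delta x i : dotp x (delta_mx ord0 i) = x ord0 i.
Proof.
rewrite /dotp (bigD1 i)//= big1 ?addr0 ?mxE ?eqxx ?mulr1// => j ji.
by rewrite mxE (negPf ji) andbF mulr0.
Qed.

End dot_product.

(** * Fourier transforms of measures carried by curves *)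

Lemma cos_lip (R : realType) (x y : R) : `|cos x - cos y| <= `|x - y|.
Proof.
wlog xy : x y / y <= x.
  by move=> h; case/orP: (le_total x y) => /h; rewrite // distrC (distrC x).
have [c _ ->] := @MVT_segment R cos (fun x => - sin x) y x xy
   (fun z _ => is_derive_cos z) (continuous_subspaceT (@continuous_cos R)).
rewrite normrM ler_piMl// normrN ler_norml sin_le1 andbT.
exact: sin_geN1.
Qed.

Section oscillation.
Variable R : realType.
Local Notation mu := (@lebesgue_measure R).

Lemma continuous_itv_integrable (g : R -> R) (a b : R) : continuous g ->
  mu.-integrable `[a, b] (EFin \o g).
Proof.
move=> cg; apply: continuous_compact_integrable; first exact: segment_compact.
exact: continuous_subspaceT.
Qed.

Lemma Rintegral_shift (g : R -> R) (a b l : R) : a <= b -> continuous g ->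
  \int[mu]_(x in `[a + l, b + l]) g x = \int[mu]_(x in `[a, b]) g (x + l).
Proof.
move=> ab cg; rewrite /Rintegral.
have d1 : derive1 (fun x : R => x + l) = cst 1.
  apply/funext => x; rewrite derive1E deriveD// derive_id derive_cst addr0//.
rewrite (@integration_by_substitution_increasing R (fun x => x + l) g)//.
- by congr fine; apply: eq_integral => x _ /=; rewrite !fctE d1 mulr1.
- by move=> x y _ _; rewrite ltrD2r.
- by rewrite d1 => x _; exact: cvg_cst.
- by rewrite d1; exact: is_cvg_cst.
- by rewrite d1; exact: is_cvg_cst.
- split => /=.
  + by move=> x _; exact: derivableD.
  + by apply: cvg_at_right_filter; apply: cvgD => //; exact: cvg_cst.
  + by apply: cvg_at_left_filter; apply: cvgD => //; exact: cvg_cst.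
- exact: continuous_subspaceT.
Qed.

Lemma Rintegral_itv_split (g : R -> R) (a b c : R) : a <= c -> c <= b ->
  continuous g ->
  \int[mu]_(x in `[a, b]) g x =
  \int[mu]_(x in `[a, c]) g x + \int[mu]_(x in `[c, b]) g x.
Proof.
move=> ac cb cg; apply/eqP; rewrite addrC -subr_eq; apply/eqP.
rewrite Rintegral_itvB ?bnd_simp//; last exact: continuous_itv_integrable.
rewrite Rintegral_itv_obnd_cbnd//.
apply: integrableS (continuous_itv_integrable c b cg) => //.
by apply: subset_itvr; rewrite bnd_simp.
Qed.

Lemma Rintegral_itv_le (g : R -> R) (a b M : R) : a <= b -> continuous g ->
  (forall t, t \in `[a, b] -> g t <= M) ->
  \int[mu]_(x in `[a, b]) g x <= M * (b - a).
Proof.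
move=> ab cg h.
apply: le_trans (_ : \int[mu]_(x in `[a, b]) M <= _).
  apply: le_Rintegral => //; try exact: continuous_itv_integrable.
  by apply: continuous_itv_integrable; exact: cst_continuous.
by rewrite Rintegral_cst//= lebesgue_measure_itv/= lte_fin; case: ltP => //= ba;
  rewrite (_ : b = a) ?subrr ?mulr0//; apply/eqP; rewrite eq_le ab ba.
Qed.

(* Shifting [t] by half a period [pi / |a|] of [cos] nearly changes the sign of
   the integrand, so the integral nearly equals its own opposite. *)
Lemma oscillatory_integral_le (phi : R -> R) (a e psi : R) :
  continuous phi -> pi <= `|a| -> 0 <= e ->
  (forall t t', t \in `[0, 1] -> t' \in `[0, 1] ->
     `|phi t - phi t' - a * (t - t')| <= e * `|t - t'|) ->
  \int[mu]_(t in `[0, 1]) cos (phi t - psi) <= pi / `|a| * (1 + e / 2).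
Proof.
move=> cphi apiE e0 h.
have pi0 : 0 < pi :> R := pi_gt0 R.
have a0 : 0 < `|a| by exact: lt_le_trans apiE.
have an0 : a != 0 by rewrite -normr_gt0.
set l := pi / `|a|.
have l0 : 0 < l by rewrite divr_gt0.
have l1 : l <= 1 by rewrite ler_pdivrMr// mul1r.
pose g t := cos (phi t - psi).
have cg : continuous g.
  move=> t; apply: continuous_comp; last exact: continuous_cos.
  by apply: continuousB; [exact: cphi|exact: cst_continuous].
have cgl : continuous (fun t => g (t + l)).
  move=> t; apply: continuous_comp; last exact: cg.
  by apply: continuousD => //; exact: cst_continuous.
have g1 t : g t <= 1 by exact: cos_le1.
have key t : t \in `[0, 1 - l] -> g t + g (t + l) <= e * l.
  rewrite in_itv /= => /andP[t0 t1].
  have ht : `|phi (t + l) - phi t - a * l| <= e * l.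
    have := h (t + l) t; rewrite (addrC t) addrK (ger0_norm (ltW l0)); apply.
      by rewrite in_itv/=; apply/andP; split; lra.
    by rewrite in_itv/=; apply/andP; split; lra.
  have -> : g t = - cos (phi t - psi + a * l).
    rewrite /g /l; have [ap|an] := leP 0 a.
      by rewrite ger0_norm// mulrCA divff// mulr1 cosDpi opprK.
    rewrite ltr0_norm// invrN !mulrN mulrCA divff// mulr1.
    by rewrite -[in LHS](subrK pi (phi t - psi)) cosDpi.
  rewrite addrC; apply: le_trans (ler_norm _) _; apply: le_trans (cos_lip _ _) _.
  by rewrite [X in `|X|](_ : _ = phi (t + l) - phi t - a * l)//; lra.
(* Adding [sA] and [sB] writes twice the integral as that of [g t + g (t + l)] over [[0, 1 - l]]
   plus two end pieces of length [l], each at most [l]. *)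
have sA : \int[mu]_(t in `[0, 1]) g t =
    \int[mu]_(t in `[0, 1 - l]) g t + \int[mu]_(t in `[1 - l, 1]) g t.
  by apply: Rintegral_itv_split => //; lra.
have sB : \int[mu]_(t in `[0, 1]) g t =
    \int[mu]_(t in `[0, l]) g t + \int[mu]_(t in `[0, 1 - l]) g (t + l).
  rewrite (@Rintegral_itv_split _ _ _ l)//; last lra.
  by rewrite -Rintegral_shift ?subrK ?add0r//; lra.
have i1 := @Rintegral_itv_le g (1 - l) 1 1 ltac:(lra) cg (fun t _ => g1 t).
have i2 := @Rintegral_itv_le g 0 l 1 ltac:(lra) cg (fun t _ => g1 t).
have i3 : \int[mu]_(t in `[0, 1 - l]) (g t + g (t + l)) <= e * l * (1 - l - 0).
  apply: Rintegral_itv_le key; first lra.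
  by move=> t; apply: continuousD; [exact: cg|exact: cgl].
rewrite RintegralD// in i3; try exact: continuous_itv_integrable.
have el0 : 0 <= e * l * l by rewrite !mulr_ge0// ltW.
by rewrite -/(g _) in sA sB *; lra.
Qed.

End oscillation.

Section measurability.
Variables (R : realType) (d : nat).

Lemma continuous_measurable_to_borelRV (f : R -> 'rV[R]_d) : continuous f ->
  measurable_fun [set: R] (f : R -> borelRV R d).
Proof.
move=> cf.
apply: (@measurability _ _ _ (borelRV R d) _ _ (@open 'rV[R]_d) erefl).
move=> _ [B oB <-].
rewrite setTI; apply: open_measurable; exact: (open_comp (fun x _ => cf x) oB).
Qed.

Lemma continuous_measurable_borelRV (f : 'rV[R]_d -> R) : continuous f ->
  measurable_fun [set: borelRV R d] f.
Proof.
move=> cf; apply: (measurability _ (RGenOpens.measurableE R)).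
move=> _ [_ [a [b ->] <-]]; rewrite setTI; apply: sub_sigma_algebra.
exact: (open_comp (fun x _ => cf x) (interval_open _ _)).
Qed.

Lemma closed_measurable_borelRV (A : set 'rV[R]_d) : closed A ->
  measurable (A : set (borelRV R d)).
Proof.
move=> cA; rewrite -[A]setCK; apply: measurableC; apply: sub_sigma_algebra.
exact: closed_openC.
Qed.

Lemma cos_dotp_continuous (xi : 'rV[R]_d) (c psi : R) :
  continuous (fun x => cos (c * dotp xi x + psi)).
Proof.
move=> x; apply: continuous_comp; last exact: continuous_cos.
apply: continuousD; last exact: cst_continuous.
by apply: continuousM; [exact: cst_continuous|exact: dotp_continuous].
Qed.

End measurability.

Section fourier.
Variables (R : realType) (d : nat).

Lemma bounded_integrable dsp (T : measurableType dsp)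
    (mu : {finite_measure set T -> \bar R}) (D : set T) (f : T -> R) (M : R) :
  measurable D -> measurable_fun D f -> (forall x, `|f x| <= M) ->
  mu.-integrable D (EFin \o f).
Proof.
move=> mD mf h; apply: measurable_bounded_integrable => //.
  by rewrite ltey_eq fin_num_measure.
exists M; split; first exact: num_real.
by move=> N MN x _ /=; apply: le_trans (h x) (ltW MN).
Qed.

(** The left side is the real part of [expi (- psi) * fourier mu xi]. Such projections reduce
    estimates of the complex transform to real cosine integrals with a free phase. *)
Lemma fourier_projection (mu : {finite_measure set (borelRV R d) -> \bar R})
    (xi : 'rV[R]_d) (psi : R) :
  cos psi * complex.Re (fourier mu xi) + sin psi * complex.Im (fourier mu xi) =
  \int[mu]_x cos (2 * pi * dotp xi x + psi).
Proof.
have ic : mu.-integrable setT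
    (EFin \o (fun x : borelRV R d => cos (- (2 * pi * dotp x xi)))).
  apply: (@bounded_integrable _ _ _ _ _ 1) => //; last first.
    by move=> x; exact: cos_max.
  under eq_fun do rewrite cosN dotpC -[_ * _]addr0.
  apply: continuous_measurable_borelRV; exact: cos_dotp_continuous.
have is_ : mu.-integrable setT
    (EFin \o (fun x : borelRV R d => sin (- (2 * pi * dotp x xi)))).
  apply: (@bounded_integrable _ _ _ _ _ 1) => //; last first.
    by move=> x; exact: sin_max.
  under eq_fun do rewrite sinN dotpC -cosDpihalf.
  apply: continuous_measurable_borelRV; exact: cos_dotp_continuous.
rewrite /fourier /cintegral /= -!RintegralZl//.
rewrite -RintegralD//; last 2 first.
- exact: (integrableZl measurableT (cos psi) ic).
- exact: (integrableZl measurableT (sin psi) is_).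
congr fine; apply: eq_integral => x _; congr EFin.
by rewrite cosN sinN cosD (dotpC x); ring.
Qed.

Lemma polar_form (a b : R) : exists r psi,
  [/\ 0 <= r, a = r * cos psi & b = r * sin psi].
Proof.
pose r := Num.sqrt (a ^+ 2 + b ^+ 2).
have ab0 : 0 <= a ^+ 2 + b ^+ 2 by rewrite addr_ge0 ?sqr_ge0.
have r0 : 0 <= r by exact: sqrtr_ge0.
have rr : r ^+ 2 = a ^+ 2 + b ^+ 2 by rewrite sqr_sqrtr.
have [re0|rn0] := eqVneq r 0.
  exists 0, 0; split => //; rewrite mul0r; nra.
have rp : 0 < r by rewrite lt_def rn0.
have ar : -1 <= a / r <= 1.
  rewrite -ler_norml normrM normrV ?unitfE// (ger0_norm r0) ler_pdivrMr// mul1r.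
  by rewrite -(ger0_norm r0) -!sqrtr_sqr ler_sqrt ?sqr_ge0// rr lerDl sqr_ge0.
have sE : r * Num.sqrt (1 - (a / r) ^+ 2) = `|b|.
  rewrite -{1}(ger0_norm r0) -sqrtr_sqr -sqrtrM ?sqr_ge0// -sqrtr_sqr.
  by congr Num.sqrt; rewrite mulrBr mulr1 -exprMn mulrCA divff// mulr1; lra.
have [b0|b0] := leP 0 b.
  exists r, (acos (a / r)); rewrite acosK ?in_itv// sin_acos// sE ger0_norm//.
  by split => //; rewrite mulrCA divff// mulr1.
exists r, (- acos (a / r)); rewrite cosN sinN acosK ?in_itv// sin_acos//.
rewrite mulrN sE ltr0_norm// opprK.
by split => //; rewrite mulrCA divff// mulr1.
Qed.

(** When [psi] is the argument of the transform, the projection on it equals the modulus. *)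
Lemma fourier_le (mu : {finite_measure set (borelRV R d) -> \bar R})
    (xi : 'rV[R]_d) (M : R) :
  (forall psi, \int[mu]_x cos (2 * pi * dotp xi x + psi) <= M) ->
  `|fourier mu xi| <= (M%:C)%C.
Proof.
move=> h; have [r [psi [r0 re im]]] :=
  polar_form (complex.Re (fourier mu xi)) (complex.Im (fourier mu xi)).
have := h psi; rewrite -fourier_projection.
have -> : `|fourier mu xi| = (r%:C)%C.
  case: (fourier mu xi) re im => a b /= -> ->.
  rewrite normc_def /= -[RHS]/(Complex r 0); congr Complex.
  by rewrite !exprMn -mulrDr cos2Dsin2 mulr1 sqrtr_sqr ger0_norm.
rewrite re im lecR mulrCA (mulrCA (sin _)) -mulrDr -!expr2.
by rewrite cos2Dsin2 mulr1.
Qed.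

Lemma fourier_sqr_le (mu : {finite_measure set (borelRV R d) -> \bar R})
    (xi : 'rV[R]_d) (M : R) : `|fourier mu xi| <= (M%:C)%C ->
  complex.Re (fourier mu xi) ^+ 2 + complex.Im (fourier mu xi) ^+ 2 <= M ^+ 2.
Proof.
case: (fourier mu xi) => a b /=.
rewrite normc_def /= lecR => h.
have ab0 : 0 <= a ^+ 2 + b ^+ 2 by rewrite addr_ge0 ?sqr_ge0.
rewrite -(sqr_sqrtr ab0).
by apply: lerXn2r => //; rewrite nnegrE ?sqrtr_ge0//; apply: le_trans h; exact: sqrtr_ge0.
Qed.

End fourier.

Section curve_average.
Variables (R : realType) (d : nat) (s : nat -> R -> 'rV[R]_d).
Hypothesis cs : forall j, continuous (s j).
Variable n : nat.
Local Notation leb := (@lebesgue_measure R).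
Local Notation unif := (uniform_prob (@ltr01 R)).

Let ms j : measurable_fun [set: R] (s j : R -> borelRV R d) :=
  continuous_measurable_to_borelRV (cs (j := j)).

Let push (j : nat) : {measure set (borelRV R d) -> \bar R} :=
  measure_function_pushforward__canonical__measure_function_Measure unif (ms j).

(** The curves are total maps on [R], but [unif] is the uniform law on [[0, 1]], so only that
    stretch of each curve carries mass. *)
Definition curve_average : set (borelRV R d) -> \bar R :=
  mscale n%:R^-1%:nng (msum push n).

HB.instance Definition _ := Measure.on curve_average.

Hypothesis n0 : (0 < n)%N.

Let curve_averageE A : curve_average A =
  (n%:R^-1%:E * \sum_(j < n) unif (s j @^-1` A))%E.
Proof. by []. Qed.

Let curve_averageT : curve_average setT = 1%E.
Proof.
rewrite curve_averageE (eq_bigr (fun=> 1%E)) => [|j _]; last first.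
  by rewrite preimage_setT probability_setT.
rewrite sumEFin sumr_const card_ord -EFinM mulVf// pnatr_eq0 -lt0n//.
Qed.

HB.instance Definition _ :=
  Measure_isProbability.Build _ _ _ curve_average curve_averageT.

Lemma curve_average_supported (A : set 'rV[R]_d) :
  (forall j t, A (s j t)) -> curve_average (~` A) = 0%E.
Proof.
move=> h; rewrite curve_averageE big1 ?mule0// => j _.
rewrite (_ : _ @^-1` _ = set0) ?measure0//.
by apply/seteqP; split => // t /=; exact.
Qed.

Lemma Rintegral_curve_average (f : 'rV[R]_d -> R) :
  continuous f -> (forall x, `|f x| <= 1) ->
  \int[curve_average]_x f x =
  n%:R^-1 * \sum_(j < n) \int[leb]_(t in `[0, 1]) f (s j t).
Proof.
move=> cf f1.
have mf := continuous_measurable_borelRV cf.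
(* Adding 1 makes the integrand nonnegative, as the integral formulas for scaled, summed and
   pushed-forward measures require; it cancels at the end because both sides have total mass 1. *)
have f0 x : 0 <= f x + 1 by have := f1 x; rewrite ler_norml; lra.
have cfs j : continuous (fun t => f (s j t)).
  by move=> t; apply: continuous_comp; [exact: cs|exact: cf].
have cfs1 j : continuous (fun t => f (s j t) + 1).
  by move=> t; apply: continuousD; [exact: cfs|exact: cst_continuous].
have mf1 : measurable_fun [set: borelRV R d] (fun x => (f x + 1)%:E).
  by apply/measurable_EFinP; exact: measurable_funD.
have intf : curve_average.-integrable setT (EFin \o f).
  exact: (@bounded_integrable _ _ _ _ _ _ 1).
have E1 : \int[curve_average]_x (f x + 1) = \int[curve_average]_x f x + 1.
  rewrite RintegralD//; last first.
    by apply: (@bounded_integrable _ _ _ _ _ _ 1) => // x; rewrite normr1.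
  congr (_ + _); rewrite Rintegral_cst// mul1r.
  by have -> : 1 = fine 1%E :> R by []; congr fine; exact: curve_averageT.
have leb01 : fine (leb `[0, 1]) = 1 :> R.
  by rewrite lebesgue_measure_itv/= lte_fin ltr01 /= subr0.
have E2 : \int[curve_average]_x (f x + 1) =
    n%:R^-1 * \sum_(j < n) \int[leb]_(t in `[0, 1]) (f (s j t) + 1).
  have E3 : (\int[curve_average]_x (f x + 1)%:E =
      (n%:R^-1 : R)%:E * \int[msum push n]_x (f x + 1)%:E)%E.
    by apply: ge0_integral_mscale => // x _; rewrite lee_fin.
  rewrite /Rintegral E3.
  rewrite ge0_integral_measure_sum//; last by move=> x _; rewrite lee_fin.
  rewrite (eq_bigr (fun j : 'I_n => (\int[leb]_(t in `[0, 1]) (f (s j t) + 1))%:E)).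
    by rewrite sumEFin.
  move=> j _.
  rewrite ge0_integral_pushforward//; last by move=> x _; rewrite lee_fin.
  rewrite preimage_setT integral_uniform/=; last 2 first.
  - by apply/measurable_EFinP; exact: continuous_measurable_fun.
  - by move=> t; rewrite lee_fin.
  rewrite subr0 invr1 mul1e /Rintegral fineK//.
  apply: integrable_fin_num => //; exact: continuous_itv_integrable.
  exact: ms.
apply/eqP; rewrite -(inj_eq (addIr (1 : R))) -E1 E2; apply/eqP.
have n0R : n%:R != 0 :> R by rewrite pnatr_eq0 -lt0n.
under eq_bigr => j _.
  rewrite RintegralD//; last 2 first.
  - exact: continuous_itv_integrable.
  - by apply: continuous_itv_integrable; exact: cst_continuous.
  rewrite Rintegral_cst//= leb01 mulr1; over.
rewrite big_split/= mulrDr sumr_const card_ord mulVf//.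
Qed.

Lemma exists_curve_average (A : set 'rV[R]_d) : (forall j t, A (s j t)) ->
  exists mu : probability (borelRV R d) R, supported_on mu A /\
    forall (xi : 'rV[R]_d) (M : R),
      (forall psi, \sum_(j < n) \int[leb]_(t in `[0, 1])
         cos (2 * pi * dotp xi (s j t) + psi) <= n%:R * M) ->
      `|fourier mu xi| <= (M%:C)%C.
Proof.
move=> sA; exists curve_average; split; first exact: curve_average_supported.
move=> xi M h; apply: fourier_le => psi.
rewrite Rintegral_curve_average; last 2 first.
- exact: cos_dotp_continuous.
- by move=> x; exact: cos_max.
by rewrite ler_pdivrMl ?ltr0n.
Qed.

End curve_average.

(** * Wiener's lemma for a pair of parallel hyperplanes *)

Section cosine_means.
Variable R : realType.

(** Each product [2 * sin (b / 2) * cos (k * b)] is [sin (k * b + b / 2) - sin (k * b - b / 2)], so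
    the sum telescopes. *)
Lemma sum_cos (m n : nat) (b : R) :
  2 * sin (b / 2) * \sum_(k < n) cos ((m + k)%:R * b) =
  sin ((m + n)%:R * b - b / 2) - sin (m%:R * b - b / 2).
Proof.
elim: n => [|n IH]; first by rewrite big_ord0 addn0 subrr mulr0.
rewrite big_ord_recr /= mulrDr IH addnS -[(m + n).+1%:R]natr1.
have -> : ((m + n)%:R + 1) * b - b / 2 = (m + n)%:R * b + b / 2.
  by lra.
by rewrite !sinD !cosN !sinN; ring.
Qed.

Lemma cos_natmul_eq1 (b : R) (n : nat) : cos b = 1 -> cos (n%:R * b) = 1.
Proof.
move=> b1; have sb : sin b = 0.
  by apply/eqP; rewrite -norm_cos_eq1 b1 normr1.
elim: n => [|n IH]; first by rewrite mul0r cos0.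
by rewrite -natr1 mulrDl mul1r cosD IH b1 sb mulr0 subr0 mulr1.
Qed.

(** The offset [m] allows sampling only frequencies beyond the radius that occurs in [good]. *)
Definition cos_mean (m : nat) (b : R) (n : nat) : R :=
  n.+1%:R^-1 * \sum_(k < n.+1) cos ((m + k)%:R * b).

Lemma cos_mean_le1 m b n : `|cos_mean m b n| <= 1.
Proof.
rewrite normrM ger0_norm// ler_pdivrMl// mulr1.
apply: le_trans (ler_norm_sum _ _ _) _.
rewrite -[n.+1 in leRHS]card_ord -sum1_card natr_sum.
by apply: ler_sum => k _; exact: cos_max.
Qed.

(** If [cos b] is not 1, the sums stay bounded by the closed form in [sum_cos], and division by
    [n.+1] sends them to 0. *)
Lemma cos_mean_cvg m b : cos_mean m b @ \oo --> ((cos b == 1)%:R : R).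
Proof.
have [b1|b1] := eqVneq (cos b) 1.
  rewrite (_ : cos_mean m b = cst 1); first exact: cvg_cst.
  apply/funext => n /=; rewrite /cos_mean (eq_bigr (fun=> 1)) => [|k _].
    by rewrite sumr_const card_ord mulVf// pnatr_eq0.
  exact: cos_natmul_eq1.
have s0 : sin (b / 2) != 0.
  apply: contra b1 => /eqP s0; rewrite [b]splitr cosD s0 mulr0 subr0.
  by have := cos2Dsin2 (b / 2); rewrite s0 expr0n addr0 expr2 => ->.
have s20 : 0 < `|2 * sin (b / 2)| by rewrite normr_gt0 mulf_neq0.
pose M := 2 / `|2 * sin (b / 2)|.
have cM : (fun n => M * n.+1%:R^-1) @ \oo --> (0 : R).
  rewrite -[X in _ --> X](mulr0 M); apply: cvgM; first exact: cvg_cst.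
  exact: cvg_harmonic.
have cNM : (fun n => - (M * n.+1%:R^-1)) @ \oo --> (0 : R).
  by rewrite -[X in _ --> X]oppr0; exact: cvgN.
apply: squeeze_cvgr cNM cM; apply: nearW => n.
rewrite -ler_norml normrM ger0_norm// mulrC ler_wpM2r//.
rewrite ler_pdivlMr// mulrC -normrM sum_cos.
have h x : `|sin x| <= 1 :> R by exact: sin_max.
apply: le_trans (ler_normB _ _) _.
by have := h ((m + n.+1)%:R * b - b / 2); have := h (m%:R * b - b / 2); lra.
Qed.

End cosine_means.

Lemma integrable_sum_EFin dsp (T : measurableType dsp) (R : realType)
    (mu : {measure set T -> \bar R}) (n : nat) (f : nat -> T -> R) :
  (forall k, mu.-integrable setT (EFin \o f k)) ->
  mu.-integrable setT (EFin \o (fun x => \sum_(k < n) f k x)).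
Proof.
move=> h; elim: n => [|n IH].
  under eq_fun do rewrite big_ord0; exact: integrable0.
under eq_fun do rewrite big_ord_recr /=; exact: (integrableD measurableT IH (h n)).
Qed.

Lemma Rintegral_sum dsp (T : measurableType dsp) (R : realType)
    (mu : {measure set T -> \bar R}) (n : nat) (f : nat -> T -> R) :
  (forall k, mu.-integrable setT (EFin \o f k)) ->
  \int[mu]_x (\sum_(k < n) f k x) = \sum_(k < n) \int[mu]_x f k x.
Proof.
move=> h; elim: n => [|n IH].
  under eq_Rintegral do rewrite big_ord0.
  by rewrite /Rintegral integral0 big_ord0.
under eq_Rintegral do rewrite big_ord_recr /=.
by rewrite RintegralD ?IH ?big_ord_recr//; exact: integrable_sum_EFin.
Qed.

Section wiener.
Variables (R : realType) (d : nat) (mu : probability (borelRV R d) R).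
Variables (th : 'rV[R]_d).

Lemma measurable_hyperplane (c : R) :
  measurable ([set x | dotp th x = c] : set (borelRV R d)).
Proof.
apply: closed_measurable_borelRV.
apply: closed_level_set; exact: dotp_continuous.
Qed.

(** By dominated convergence the means tend to the mass of [E]. Besides the hyperplane at [c], [E]
    contains the translates that sampling at integer multiples of [s] cannot tell from it; a lower
    bound needs only that the hyperplane itself lies in [E]. *)
Lemma hyperplane_mass_le_mean (m : nat) (s c eta : R) : 0 < eta ->
  \forall n \near \oo, fine (mu [set x | dotp th x = c]) - eta <=
     \int[mu]_x cos_mean m (s * (dotp th x - c)) n.
Proof.
move=> eta0.
have mD n : measurable_fun [set: borelRV R d]
    (fun x => cos_mean m (s * (dotp th x - c)) n).
  apply: measurable_funM => //; apply: measurable_sum => k.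
  apply: continuous_measurable_borelRV => x.
  have -> : (fun y => cos ((m + k)%:R * (s * (dotp th y - c)))) =
      (fun y => cos ((m + k)%:R * s * dotp th y + - ((m + k)%:R * s * c))).
    by apply/funext => y; congr cos; ring.
  exact: cos_dotp_continuous.
pose E : set (borelRV R d) := [set x | cos (s * (dotp th x - c)) = 1].
have mE : measurable E.
  apply: closed_measurable_borelRV; rewrite /E.
  under eq_fun do rewrite mulrBr -[- (s * c)]/(- (s * c)).
  apply: closed_level_set; exact: cos_dotp_continuous.
have [//|||||_ _ +] := @dominated_convergence _ _ _ mu setT measurableT
  (fun n x => (cos_mean m (s * (dotp th x - c)) n)%:E)
  (fun x => (\1_E x)%:E) (cst 1%E).
- by move=> n; apply/measurable_EFinP; exact: mD.
- by apply/measurable_EFinP; exact: measurable_indic.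
- apply: aeW => x _; apply: cvg_EFin; first exact: nearW.
  rewrite /= indicE; have := @cos_mean_cvg _ m (s * (dotp th x - c)).
  by rewrite (_ : (x \in E) = (cos (s * (dotp th x - c)) == 1))//;
    apply/idP/eqP; rewrite inE.
- by apply: (@bounded_integrable _ _ _ _ _ (cst 1) 1) => // x; rewrite normr1.
- by apply: aeW => x n _; rewrite lee_fin; exact: cos_mean_le1.
rewrite integral_indic// setIT => cv.
have fE : fine (mu [set x | dotp th x = c]) <= fine (mu E).
  apply: fine_le; rewrite ?fin_num_measure//; first exact: measurable_hyperplane.
  apply: le_measure; rewrite ?inE//; first exact: measurable_hyperplane.
  by move=> x /= xc; rewrite /E /= xc subrr mulr0 cos0.
have cv' : (\int[mu]_x (cos_mean m (s * (dotp th x - c)) n)%:E)%E @[n --> \oo]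
    --> (fine (mu E))%:E by rewrite fineK ?fin_num_measure.
have /cvgrPdist_lt cvf : \int[mu]_x cos_mean m (s * (dotp th x - c)) n @[n --> \oo]
    --> fine (mu E) by exact: fine_cvg cv'.
near=> n; have : `|fine (mu E) - \int[mu]_x cos_mean m (s * (dotp th x - c)) n| < eta.
  by near: n; exact: cvf.
rewrite ltr_distl => /andP[_ +]; lra.
Unshelve. all: by end_near. Qed.

(** A Bessel-type inequality: the transform along [th] is correlated with that of two point masses
    [a] and [b] at [c] and [- c]. In the mean the correlation is asymptotically at least
    [a^2 + b^2], and the squared modulus of the second transform tends to [a^2 + b^2]; what remains
    is bounded by [eps^2]. *)
Lemma wiener (eps c : R) : enorm th = 1 -> 0 < c -> good eps mu ->
  fine (mu [set x | dotp th x = c]) ^+ 2 +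
  fine (mu [set x | dotp th x = - c]) ^+ 2 <= eps ^+ 2.
Proof.
move=> th1 c0 [r r0 hr].
set a := fine _; set b := fine _.
have a0 : 0 <= a by exact: fine_ge0.
have b0 : 0 <= b by exact: fine_ge0.
(* With this spacing the phase [4 * pi * c * t k], the relative phase of the two hyperplanes, equals
   [pi * (m + k)], so the cross term [2 a b] only changes sign from one [k] to the next. The offset
   [m] puts every sampled frequency beyond [r]. *)
pose s := (4 * c)^-1.
have s0 : 0 < s by rewrite invr_gt0 mulr_gt0.
pose m := (Num.truncn (r / s)).+1.
pose t (k : nat) := (m + k)%:R * s.
have tr k : r <= t k.
  rewrite /t -ler_pdivrMr//; apply: (@le_trans _ _ m%:R).
    by apply: ltW; exact: truncnS_gt.
  by rewrite ler_nat leq_addr.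
have t0 k : 0 <= t k by apply: le_trans (tr k); exact: ltW.
pose J (z : R) k := \int[mu]_x cos (2 * pi * dotp (t k *: th) x + z).
(* [F = u + iv] is the transform at [t th] and [p = a e^(i w) + b e^(- i w)],
   with [w = 2 pi c t]; this is [2 Re (F p) <= |F|^2 + |p|^2]. *)
have key k : 2 * (a * J (- (2 * pi * c * t k)) k + b * J (2 * pi * c * t k) k) <=
    eps ^+ 2 + a ^+ 2 + b ^+ 2 + 2 * a * b * (-1) ^+ (m + k).
  have tk : r <= enorm (t k *: th) by rewrite enormZ th1 mulr1 ger0_norm.
  have := fourier_sqr_le (hr _ tk).
  rewrite /J -!fourier_projection cosN sinN.
  have -> : (-1) ^+ (m + k) = cos (2 * (2 * pi * c * t k)) :> R.
    have -> : 2 * (2 * pi * c * t k) = 0 + pi *+ (m + k).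
      rewrite /t /s -mulr_natr; field.
      by rewrite gt_eqF.
    by rewrite alternatingn ?cos0 ?mulr1//; exact: cosDpi.
  set w := 2 * pi * c * t k; have -> : 2 * w = w + w by ring.
  rewrite cosD.
  set u := complex.Re _; set v := complex.Im _; set C := cos _; set S := sin _.
  move=> uv; have CS : C ^+ 2 + S ^+ 2 = 1 by exact: cos2Dsin2.
  have h1 : 0 <= (u - (a + b) * C) ^+ 2 by exact: sqr_ge0.
  have h2 : 0 <= (v + (a - b) * S) ^+ 2 by exact: sqr_ge0.
  have e1 : (a ^+ 2 + b ^+ 2) * (C ^+ 2 + S ^+ 2) = a ^+ 2 + b ^+ 2.
    by rewrite CS mulr1.
  lra.
pose D z n := \int[mu]_x cos_mean m (2 * pi * s * (dotp th x - z)) n.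
have DJ z n : D z n = n.+1%:R^-1 * \sum_(k < n.+1) J (- (2 * pi * z * t k)) k.
  have mJ k : mu.-integrable setT (EFin \o (fun x : borelRV R d =>
      cos ((m + k)%:R * (2 * pi * s * (dotp th x - z))))).
    apply: (@bounded_integrable _ _ _ _ _ _ 1) => // [|x]; last exact: cos_max.
    apply: continuous_measurable_borelRV.
    under eq_fun do rewrite mulrA mulrBr.
    exact: cos_dotp_continuous.
  rewrite /D RintegralZl//; last first.
    exact: (@integrable_sum_EFin _ _ _ mu n.+1
      (fun k x => cos ((m + k)%:R * (2 * pi * s * (dotp th x - z))))).
  rewrite (@Rintegral_sum _ _ _ mu n.+1
      (fun k x => cos ((m + k)%:R * (2 * pi * s * (dotp th x - z)))))//; congr (_ * _); apply: eq_bigr => k _.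
  congr fine; apply: eq_integral => x _; congr (cos _)%:E.
  by rewrite dotpZl /t; ring.
have avg n : 2 * (a * D c n + b * D (- c) n) <=
    eps ^+ 2 + a ^+ 2 + b ^+ 2 + 2 * a * b * n.+1%:R^-1.
  have n0 : 0 < n.+1%:R :> R by rewrite ltr0n.
  have n0' : n.+1%:R != 0 :> R by rewrite gt_eqF.
  (* Partial sums of alternating signs are at most 1, so the cross term contributes at most
     [2 * a * b / n.+1] to the mean. *)
  have alt : \sum_(k < n.+1) (-1) ^+ (m + k) <= 1 :> R.
    under eq_bigr do rewrite exprD.
    rewrite -big_distrr /=.
    have : \sum_(k < n.+1) (-1) ^+ k = (~~ odd n)%:R :> R.
      elim: (n) => [|p IH]; first by rewrite big_ord1.
      by rewrite big_ord_recr /= IH -signr_odd /=; case: (odd p) => /=; lra.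
    move=> ->; rewrite -signr_odd; case: (odd m); case: (odd n) => /=; lra.
  have e : \sum_(k < n.+1) J (- (2 * pi * - c * t k)) k =
      \sum_(k < n.+1) J (2 * pi * c * t k) k.
    by apply: eq_bigr => k _; congr (J _ k); ring.
  rewrite !DJ e -(ler_pM2l n0) [leRHS]mulrDr.
  have -> : n.+1%:R * (2 * a * b * n.+1%:R^-1) = 2 * a * b by field.
  have -> : n.+1%:R * (2 * (a * (n.+1%:R^-1 * \sum_(k < n.+1) J (- (2 * pi * c * t k)) k) +
      b * (n.+1%:R^-1 * \sum_(k < n.+1) J (2 * pi * c * t k) k))) =
      \sum_(k < n.+1) 2 * (a * J (- (2 * pi * c * t k)) k + b * J (2 * pi * c * t k) k).
    rewrite -mulr_sumr big_split /= -!mulr_sumr.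
    by field.
  apply: le_trans; first by apply: ler_sum => k _; exact: key.
  rewrite big_split /= sumr_const card_ord -mulr_sumr -[(eps ^+ 2 + _ + _) *+ _]mulr_natl lerD2l.
  by rewrite ler_piMr// !mulr_ge0.
(* In the limit [avg] amounts to [2 (a^2 + b^2) <= eps^2 + a^2 + b^2]. The choice of [q] makes
   replacing the means by [a - q] and [b - q] cost at most [eta / 2]. *)
apply/ler_addgt0Pr => eta eta0.
pose q := eta / (4 * (a + b + 1)).
have ab1 : 0 < a + b + 1 by lra.
have q0 : 0 < q by rewrite divr_gt0// mulr_gt0.
have qE : 4 * (a + b + 1) * q = eta.
  by rewrite /q mulrCA divff ?mulr1// gt_eqF// mulr_gt0.
have hn : \forall n \near \oo, `|0 - 2 * a * b * n.+1%:R^-1| < eta / 2.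
  have h : (fun n => 2 * a * b * n.+1%:R^-1) @ \oo --> (0 : R).
    rewrite -[X in _ --> X](mulr0 (2 * a * b)); apply: cvgM; first exact: cvg_cst.
    exact: cvg_harmonic.
  by move/cvgrPdist_lt : h; apply; rewrite divr_gt0.
near \oo => n.
have Da : a - q <= D c n by near: n; exact: hyperplane_mass_le_mean.
have Db : b - q <= D (- c) n by near: n; exact: hyperplane_mass_le_mean.
have nq : `|0 - 2 * a * b * n.+1%:R^-1| < eta / 2 by near: n.
rewrite sub0r normrN ltr_norml in nq; case/andP: nq => _ nq.
have aD := ler_wpM2l a0 Da; have bD := ler_wpM2l b0 Db; have aD2 := avg n.
suff : 2 * (a * (a - q) + b * (b - q)) <= eps ^+ 2 + a ^+ 2 + b ^+ 2 + eta / 2.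
  have : 4 * q * (a + b) <= eta by rewrite -qE; lra.
  by rewrite !expr2; lra.
apply: le_trans (_ : 2 * (a * D c n + b * D (- c) n) <= _); first by lra.
by apply: le_trans aD2 _; rewrite lerD2l ltW.
Unshelve. all: by end_near. Qed.

End wiener.

(* Among finitely many pairs of hyperplanes covering the support one carries
   mass at least [1 / N]; Wiener's lemma applies to its normal direction. *)
Lemma not_good_on_hyperplanes (R : realType) (d N : nat) (A : set 'rV[R]_d)
    (theta : 'I_N -> 'rV[R]_d) (c : 'I_N -> R) (eps : R)
    (mu : probability (borelRV R d) R) :
  closed A -> (forall i, enorm (theta i) = 1) -> (forall i, 0 < c i) ->
  (forall y, A y -> exists i, dotp (theta i) y = c i \/ dotp (theta i) y = - c i) ->
  0 < eps -> eps < 1 / (Num.sqrt 2 * N%:R) ->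
  good eps mu -> supported_on mu A -> False.
Proof.
move=> clA th1 c0 cov eps0 epsN gmu smu.
(* For [N = 0] the convention that 0 has inverse 0 turns the upper bound on [eps] into 0. *)
have N0 : (0 < N)%N.
  rewrite lt0n; apply/eqP => NE; move: epsN.
  by rewrite NE mulr0 invr0 mulr0; lra.
have NR : 0 < N%:R :> R by rewrite ltr0n.
pose H i (e : R) : set (borelRV R d) := [set x | dotp (theta i) x = e].
have mH i e : measurable (H i e) by exact: measurable_hyperplane.
pose m i := fine (mu (H i (c i))) + fine (mu (H i (- c i))).
have m0 i : 0 <= m i by rewrite addr_ge0// fine_ge0.
(* The factor [sqrt 2] comes from [(a + b)^2 <= 2 (a^2 + b^2) <= 2 eps^2]. *)
have mle i : m i ^+ 2 < N%:R^-1 ^+ 2.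
  have := wiener (th1 i) (c0 i) gmu; rewrite -/(H i _) -/(H i _) => w.
  have : m i ^+ 2 <= 2 * eps ^+ 2.
    rewrite /m; move: w; set a := fine _; set b := fine _ => w.
    have : 0 <= (a - b) ^+ 2 by exact: sqr_ge0.
    lra.
  move=> /le_lt_trans; apply.
  have s2 : Num.sqrt 2 ^+ 2 = 2 :> R by rewrite sqr_sqrtr.
  have s20 : 0 < Num.sqrt 2 :> R by rewrite sqrtr_gt0.
  have : Num.sqrt 2 * eps < N%:R^-1.
    move: epsN; rewrite div1r invfM mulrC ltr_pdivlMr// mulrC//.
  move=> h; rewrite -{1}s2 -exprMn.
  by rewrite ltr_pXn2r// nnegrE ?invr_ge0// mulr_ge0// ltW.
have mN i : m i < N%:R^-1.
  by have := mle i; rewrite ltr_pXn2r// nnegrE ?invr_ge0.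
have mA : measurable (A : set (borelRV R d)) by exact: closed_measurable_borelRV.
pose U i := H i (c i) `|` H i (- c i).
have mU i : measurable (U i) by exact: measurableU.
pose B := \big[setU/set0]_(i < N) U i.
have mB : measurable B by exact: bigsetU_measurable.
have AB : A `<=` B.
  move=> y /cov[i hi]; rewrite /B (bigD1 i)//=; left.
  by case: hi => hi; [left|right].
have h1 : (mu setT <= mu B)%E.
  rewrite -(setvU A) measureU ?setICl//; last exact: measurableC.
  rewrite [X in (X + _)%E](smu : mu (~` A) = 0%E) add0e.
  by apply: le_measure => //; rewrite inE.
have h2 : (mu B <= \sum_(i < N) (m i)%:E)%E.
  suff : measurable B /\ (mu B <= \sum_(i < N) (m i)%:E)%E by case.
  rewrite /B; elim/big_rec2 : _ => [|i e X _ [mX IH]]; first by rewrite measure0.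
  split; first exact: measurableU.
  apply: le_trans (measureU2 _ _ _) _ => //.
  apply: leeD => //; rewrite EFinD !fineK ?fin_num_measure//.
  exact: measureU2.
move: (le_trans h1 h2); rewrite probability_setT sumEFin lee_fin; apply/negP.
rewrite -ltNge; have -> : 1 = \sum_(i < N) N%:R^-1 :> R.
  by rewrite sumr_const card_ord -[RHS]mulr_natl divff// gt_eqF.
apply: ltr_sum => //.
by apply/hasP; exists (Ordinal N0) => //; exact: mem_index_enum.
Qed.

(** * Good measures from almost flat pieces *)

Lemma finite_pos_lower_bound (R : realType) (J : finType) (f : J -> R) :
  (forall j, 0 < f j) -> exists2 c, 0 < c & forall j, c <= f j.
Proof.
move=> f0; exists (\big[Num.min/1]_j f j).
  by elim/big_ind : _ => // x y x0 y0; rewrite lt_min x0.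
by move=> j; exact: bigmin_le_cond.
Qed.

Lemma exists_curve_average_fin (R : realType) (d : nat) (J : finType)
    (s : J -> R -> 'rV[R]_d) (A : set 'rV[R]_d) :
  (0 < #|J|)%N -> (forall j, continuous (s j)) -> (forall j t, A (s j t)) ->
  exists mu : probability (borelRV R d) R, supported_on mu A /\
    forall (xi : 'rV[R]_d) (M : R),
      (forall psi, \sum_j \int[lebesgue_measure]_(t in `[0, 1])
         cos (2 * pi * dotp xi (s j t) + psi) <= #|J|%:R * M) ->
      `|fourier mu xi| <= (M%:C)%C.
Proof.
move=> J0 cs sA; have [j0 _] : exists j0 : J, true.
  by case/card_gt0P : J0 => j _; exists j.
pose s' k := s (nth j0 (enum J) k).
have [mu [muA hmu]] := @exists_curve_average R d s' (fun k => cs _) _ J0 A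
  (fun k => sA _).
exists mu; split=> // xi M h; apply: hmu => psi.
rewrite -(big_mkord predT (fun k => \int[lebesgue_measure]_(t in `[0, 1])
  cos (2 * pi * dotp xi (s' k t) + psi))) cardE.
by rewrite -(big_nth j0 predT (fun j => \int[lebesgue_measure]_(t in `[0, 1])
  cos (2 * pi * dotp xi (s j t) + psi))) -cardE big_enum; exact: h.
Qed.

Section general_position.
Variables (R : realType) (d : nat).

Lemma compact_sphere : compact [set x : 'rV[R]_d | `|x| = 1].
Proof.
apply: bounded_closed_compact.
  by exists 1; split => // M M1 x /= ->; exact: ltW.
by apply: closed_level_set => x; exact: norm_continuous.
Qed.

(** Compactness turns exact orthogonality into a uniform gap: for a set [T] of more than [B]
    indices, the sum of [|dotp xi (v j)|] over [T] has no zero on the unit sphere, hence a positive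
    minimum there, and there are finitely many [T]. *)
Lemma uniform_orthogonality (J : finType) (v : J -> 'rV[R]_d) (B : nat) :
  (forall xi, xi != 0 -> (#|[pred j | dotp xi (v j) == 0%R]| <= B)%N) ->
  exists2 c : R, 0 < c & forall xi,
    (#|[pred j | (`|dotp xi (v j)| < c * `|xi|)%R]| <= B)%N.
Proof.
move=> hB.
have [c c0 hc] : exists2 c : R, 0 < c & forall (T : {set J}) xi, (B < #|T|)%N ->
    `|xi| = 1 -> c <= \sum_(j in T) `|dotp xi (v j)|.
  pose P (T : {set J}) (c : R) := forall xi, (B < #|T|)%N -> `|xi| = 1 ->
     c <= \sum_(j in T) `|dotp xi (v j)|.
  have ex T : exists c : R, 0 < c /\ P T c.
    have [TB|TB] := ltnP B #|T|; last first.
      by exists 1; split => // xi; rewrite ltnNge TB.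
    have [S0|/eqP/set0P S0] := EM ([set x : 'rV[R]_d | `|x| = 1] = set0).
      exists 1; split => // xi _ xi1.
      by have : [set x : 'rV[R]_d | `|x| = 1] xi by []; rewrite S0.
    have cf : continuous (fun xi => \sum_(j in T) `|dotp xi (v j)|).
      apply: continuous_big => [|j _ x].
        exact: add_continuous.
      apply: (@continuous_comp _ _ _ (fun xi => dotp xi (v j)) (fun r => `|r|)).
        rewrite (_ : (fun xi => _) = dotp (v j)); first exact: dotp_continuous.
        by apply/funext => xi; exact: dotpC.
      exact: norm_continuous.
    have [x0 + x0min] := compact_EVT_min S0 compact_sphere (continuous_subspaceT cf).
    rewrite inE /= => x01.
    exists (\sum_(j in T) `|dotp x0 (v j)|); split.
      rewrite lt_def; apply/andP; split; last by apply: sumr_ge0.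
      apply: contraL TB => /eqP z0; rewrite -leqNgt.
      have := hB x0; rewrite -normr_eq0 x01 oner_eq0 => /(_ erefl).
      apply: leq_trans; apply: subset_leq_card; apply/fintype.subsetP => j jT.
      rewrite inE -normr_eq0; apply/eqP.
      by apply: (psumr_eq0P _ z0) => // k _; exact: normr_ge0.
    by move=> xi _ xi1; apply: x0min; rewrite inE.
  have [f hf] := choice ex.
  have [c c0 cf] := finite_pos_lower_bound (fun T => (hf T).1).
  exists c => // T xi TB xi1; apply: le_trans (cf T) _; exact: (hf T).2.
(* If all terms indexed by [T] were below this threshold on the unit sphere, their sum would be
   below [c]. *)
exists (c / #|J|.+1%:R); first by rewrite divr_gt0.
move=> xi; rewrite leqNgt; apply/negP => TB.
rewrite -cardsE in TB; set T := finset _ in TB.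
have xi0 : xi != 0.
  apply: contraL TB => /eqP xi0; rewrite -leqNgt.
  rewrite (_ : T = finset.set0) ?cards0//.
  by apply/setP => j; rewrite !inE xi0 normr0 mulr0 ltNge normr_ge0.
have nxi : 0 < `|xi| by rewrite normr_gt0.
have := hc T (`|xi|^-1 *: xi) TB.
rewrite normrZ normfV normr_id mulVf ?gt_eqF// => /(_ erefl).
apply/negP; rewrite -ltNge.
apply: le_lt_trans (_ : #|T|%:R * (c / #|J|.+1%:R) < _).
  rewrite -sum1_card natr_sum mulr_suml; apply: ler_sum => j.
  rewrite inE mul1r => /ltW h.
  by rewrite dotpZl normrM normfV normr_id ler_pdivrMl// mulrC.
rewrite mulrA ltr_pdivrMr// mulrC ltr_pM2l// ltr_nat ltnS.
exact: max_card.
Qed.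


(** The sum is the value at [k] of a nonzero polynomial of degree below [d], whose coefficients are
    the coordinates of [xi]. *)
Lemma moment_roots (xi : 'rV[R]_d) (m : nat) : xi != 0 ->
  (#|[pred k : 'I_m | (\sum_(j < d) (k%:R : R) ^+ j * xi ord0 j == 0)%R]| <= d)%N.
Proof.
move=> xi0; pose p : {poly R} := \poly_(i < d) (if insub i is Some j then xi ord0 j else 0).
have pE k : p.[k] = \sum_(j < d) k ^+ j * xi ord0 j.
  by rewrite horner_poly; apply: eq_bigr => j _; rewrite valK mulrC.
have p0 : p != 0.
  apply: contra xi0 => /eqP p0; apply/eqP/rowP => j; rewrite mxE.
  by have := congr1 (fun p : {poly R} => p`_j) p0; rewrite coef0 coef_poly ltn_ord valK.
set S := [pred k | _].
have := @max_poly_roots _ p [seq (k : 'I_m)%:R | k <- enum S] p0.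
rewrite size_map -cardE => h; apply: leq_trans (size_poly d _); apply: ltnW.
apply: h.
  by apply/allP => x /mapP[k]; rewrite mem_enum inE -pE => /eqP rk ->; apply/rootP.
rewrite map_inj_uniq ?enum_uniq// => k l /eqP.
by rewrite eqr_nat => /eqP/val_inj.
Qed.

Definition moment (k : nat) : 'rV[R]_d := \row_j (k%:R ^+ j).

(* Pairing [xi] with [moment_orth q k] gives a polynomial in [k], which is zero
   only if [xi] is parallel to [q]; hence the bound on the number of roots. *)
Definition moment_orth (q : 'rV[R]_d) (k : nat) : 'rV[R]_d :=
  dotp q q *: moment k - dotp (moment k) q *: q.

Lemma dotp_moment_orth q k : dotp q (moment_orth q k) = 0.
Proof. by rewrite dotpBr !dotpZr (dotpC _ q) mulrC subrr. Qed.

Lemma moment_orth_roots (q xi : 'rV[R]_d) (m : nat) : q != 0 ->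
  (forall a, xi <> a *: q) ->
  (#|[pred k : 'I_m | dotp xi (moment_orth q k) == 0%R]| <= d)%N.
Proof.
move=> q0 xiq.
(* Up to the factor [dotp q q] this is the projection of [xi] onto the complement of [q]. Projection
   being self-adjoint, it can be moved from [moment k] to [xi]. *)
pose z := dotp q q *: xi - dotp xi q *: q.
have z0 : z != 0.
  apply/eqP => /subr0_eq zE; apply: (xiq (dotp xi q / dotp q q)).
  rewrite mulrC -scalerA -zE scalerA mulVf ?scale1r//.
  by rewrite dotpxx_eq0.
apply: leq_trans (moment_roots m z0); apply: subset_leq_card.
apply/fintype.subsetP => k; rewrite !inE => /eqP h; apply/eqP; rewrite -[RHS]h.
transitivity (dotp (moment k) z).
  by apply: eq_bigr => j _; rewrite [moment k _ _]mxE.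
by rewrite /z !dotpBr !dotpZr (dotpC xi (moment k)); ring.
Qed.

Lemma moment_orth_count (N m : nat) (q : 'I_N -> 'rV[R]_d) (xi : 'rV[R]_d) :
  (forall i, q i != 0) -> (forall i j, i != j -> forall a, q i <> a *: q j) ->
  xi != 0 ->
  (#|[pred p : 'I_N * 'I_m | dotp xi (moment_orth (q p.1) p.2) == 0%R]| <=
   m + N * d)%N.
Proof.
move=> q0 qq xi0.
rewrite -sum1_card (eq_bigl (fun p : 'I_N * 'I_m =>
  true && (dotp xi (moment_orth (q p.1) p.2) == 0))); last by move=> p; rewrite inE.
rewrite -(pair_big_dep xpredT
  (fun i (k : 'I_m) => dotp xi (moment_orth (q i) k) == 0) (fun _ _ => 1%N)) /=.
have cnt i : (\sum_(k < m | dotp xi (moment_orth (q i) k) == 0%R) 1 =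
    #|[pred k : 'I_m | dotp xi (moment_orth (q i) k) == 0%R]|)%N.
  by rewrite -sum1_card; apply: eq_bigl => k; rewrite inE.
under eq_bigr => i _ do rewrite cnt.
have [[i0 [a xiE]]|npar] := EM (exists i a, xi = a *: q i).
  rewrite (bigD1 i0) //=; apply: leq_add.
    by rewrite -[leqRHS]card_ord; exact: max_card.
  apply: leq_trans (_ : (\sum_(i < N | i != i0) d <= _)%N).
    apply: leq_sum => i ii0; apply: moment_orth_roots => // b xiE'.
    have a0 : a != 0 by apply: contraNN xi0 => /eqP a0; rewrite xiE a0 scale0r.
    have := qq i0 i; rewrite eq_sym => /(_ ii0 (a^-1 * b)); apply.
    by rewrite -scalerA -xiE' xiE scalerA mulVf// scale1r.
  rewrite sum_nat_const leq_mul2r; apply/orP; right.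
  by rewrite -[leqRHS]card_ord; exact: max_card.
apply: leq_trans (leq_addl _ _).
rewrite -[N in leqRHS]card_ord -sum_nat_const; apply: leq_sum => i _.
by apply: moment_orth_roots => // b xiE; apply: npar; exists i, b.
Qed.

End general_position.

(* [rho] is a free scale: the curves may shrink as [k] tends to 0, only the error
   relative to their length matters. *)
Definition almost_flat (R : realType) (d : nat) (A : set 'rV[R]_d)
    (q : 'rV[R]_d) : Prop :=
  forall (v : 'rV[R]_d) (k : R), dotp q v = 0 -> 0 < k ->
  exists (rho : R) (s : R -> 'rV[R]_d),
    [/\ 0 < rho, continuous s, forall t, A (s t) &
        forall t t', t \in `[0, 1] -> t' \in `[0, 1] ->
          `|s t - s t' - ((t - t') * rho) *: v| <= k * rho * `|t - t'|].

Section good_measures.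
Variables (R : realType) (d : nat).
Local Notation leb := (@lebesgue_measure R).

Lemma dotp_curve_continuous (s : R -> 'rV[R]_d) (xi : 'rV[R]_d) (c : R) :
  continuous s -> continuous (fun t => c * dotp xi (s t)).
Proof.
move=> cs t; apply: cvgM; first exact: cvg_cst.
by apply: (@continuous_comp _ _ _ s (dotp xi)); [exact: cs|exact: dotp_continuous].
Qed.

(** Along the curve the phase is [a * t] up to a function with Lipschitz constant [E]. The ratio of
    [E] to [|a|] is of order [k / c] whatever the size of [xi], and [pi / |a|] is small for large
    [xi]; each of the two contributes at most [e]. *)
Lemma curve_decay (s : R -> 'rV[R]_d) (v xi : 'rV[R]_d) (rho k c e psi : R) :
  continuous s -> 0 < rho -> 0 < c -> 0 < k -> 0 < e ->
  (forall t t', t \in `[0, 1] -> t' \in `[0, 1] ->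
     `|s t - s t' - ((t - t') * rho) *: v| <= k * rho * `|t - t'|) ->
  c * `|xi| <= `|dotp xi v| ->
  d%:R * pi * k <= c * e -> 1 + e^-1 <= 2 * rho * c * `|xi| ->
  \int[leb]_(t in `[0, 1]) cos (2 * pi * dotp xi (s t) + psi) <= 2 * e.
Proof.
move=> cs rho0 c0 k0 e0 hs xiv hk hxi.
have pi0 : 0 < pi :> R := pi_gt0 R.
pose a := 2 * pi * rho * dotp xi v.
pose E := 2 * pi * d%:R * `|xi| * k * rho.
have E0 : 0 <= E by rewrite /E !mulr_ge0// ltW.
have aE : `|a| = 2 * pi * rho * `|dotp xi v|.
  by rewrite /a normrM ger0_norm// !mulr_ge0// ltW.
have aX : pi * (2 * rho * c * `|xi|) <= `|a|.
  rewrite aE [leLHS](_ : _ = 2 * pi * rho * (c * `|xi|)); last by ring.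
  by rewrite ler_wpM2l// !mulr_ge0// ltW.
have e10 : 0 < e^-1 by rewrite invr_gt0.
(* The summand 1 gives [pi <= |a|], required for the half-period shift; the summand [e^-1] gives
   [pi / |a| <= e]. *)
have a1 : pi * (1 + e^-1) <= `|a|.
  by apply: le_trans aX; rewrite ler_wpM2l// ltW.
have a0 : 0 < `|a| by apply: lt_le_trans a1; rewrite mulr_gt0// addr_gt0.
have := @oscillatory_integral_le R (fun t => 2 * pi * dotp xi (s t)) a E (- psi).
rewrite opprK => h.
apply: le_trans (h _ _ E0 _) _.
- exact: dotp_curve_continuous.
- apply: le_trans a1; apply: ler_peMr; first exact: ltW.
  by rewrite lerDl ltW.
- move=> t t' t01 t01'.
  have -> : 2 * pi * dotp xi (s t) - 2 * pi * dotp xi (s t') - a * (t - t') =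
      2 * pi * dotp xi (s t - s t' - ((t - t') * rho) *: v).
    by rewrite !dotpBr dotpZr /a; ring.
  have p2 : 0 <= 2 * pi :> R by rewrite mulr_ge0// ltW.
  rewrite normrM (ger0_norm p2) /E -!mulrA ler_pM2l// ler_pM2l//.
  apply: le_trans (normr_dotp _ _) _.
  by rewrite -!mulrA ler_wpM2l// ler_wpM2l// mulrA; exact: hs.
rewrite mulrDr mulr1 mulr_natl mulr2n; apply: lerD.
  rewrite ler_pdivrMr// -ler_pdivrMl// mulrC; apply: le_trans (le_trans _ a1) => //.
  by rewrite mulrDr lerDr mulr1 ltW.
rewrite mulrAC ler_pdivrMr//; apply: le_trans (_ : e * (pi * (2 * rho * c * `|xi|)) <= _).
  rewrite /E; have -> : pi * (2 * pi * d%:R * `|xi| * k * rho / 2) =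
    pi * (rho * `|xi|) * (d%:R * pi * k) by field.
  have -> : e * (pi * (2 * rho * c * `|xi|)) = pi * (rho * `|xi|) * (2 * (c * e)).
    by ring.
  have ce : 0 < c * e by rewrite mulr_gt0.
  apply: ler_wpM2l; first by rewrite !mulr_ge0// ltW.
  by apply: le_trans hk _; lra.
by rewrite ler_wpM2l// ltW.
Qed.

Lemma good_measure_of_almost_flat (A : set 'rV[R]_d) (N : nat)
    (q : 'I_N -> 'rV[R]_d) (delta : R) :
  (0 < N)%N -> (forall i, q i != 0) ->
  (forall i j, i != j -> forall a, q i <> a *: q j) ->
  (forall i, almost_flat A (q i)) -> 0 < delta ->
  exists mu : probability (borelRV R d) R,
    good (1 / N%:R + delta) mu /\ supported_on mu A.
Proof.
move=> N0 q0 qq qA delta0.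
(* Large enough for [d / m <= delta / 2]. The other half of [delta] pays for the remaining curves,
   each contributing at most [2 * e] with [e = delta / 4]. *)
pose m := (Num.truncn (2 * d%:R / delta)).+1.
have m0 : 0 < m%:R :> R by rewrite ltr0n.
have dm : d%:R <= m%:R * (delta / 2).
  have := ltW (truncnS_gt (2 * d%:R / delta)); rewrite ler_pdivrMr// -/m; lra.
pose J := ('I_N * 'I_m)%type.
pose v (p : J) := moment_orth (q p.1) p.2.
have [c c0 hc] := uniform_orthogonality (fun xi => @moment_orth_count _ _ N m q xi q0 qq).
pose e := delta / 4.
have e0 : 0 < e by rewrite divr_gt0.
have pi0 : 0 < pi :> R := pi_gt0 R.
have d1 : 0 < d%:R + 1 :> R by rewrite ltr_wpDl.
pose k := c * e / ((d%:R + 1) * pi).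
have k0 : 0 < k by rewrite divr_gt0// mulr_gt0.
have hk : d%:R * pi * k <= c * e.
  have : (d%:R + 1) * pi * k = c * e by rewrite /k mulrC divfK// gt_eqF// mulr_gt0.
  by move=> <-; rewrite ler_pM2r// ler_pM2r// lerDl.
have /choice[rs hrs] : forall p : J, exists rs : R * (R -> 'rV[R]_d),
    [/\ 0 < rs.1, continuous rs.2, forall t, A (rs.2 t) &
        forall t t', t \in `[0, 1] -> t' \in `[0, 1] ->
          `|rs.2 t - rs.2 t' - ((t - t') * rs.1) *: v p| <= k * rs.1 * `|t - t'|].
  move=> p; have [rho [s hs]] := qA p.1 (v p) k (dotp_moment_orth _ _) k0.
  by exists (rho, s).
have rs0 p : 0 < (rs p).1 by case: (hrs p).
have crs p : continuous (rs p).2 by case: (hrs p).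
have Ars p t : A ((rs p).2 t) by case: (hrs p).
have [rho rho0 hrho] := finite_pos_lower_bound rs0.
have cardJ : #|{: J}| = (N * m)%N by rewrite card_prod !card_ord.
have J0 : (0 < #|{: J}|)%N by rewrite cardJ muln_gt0 N0.
have [mu [muA hmu]] := exists_curve_average_fin J0 crs Ars.
exists mu; split => //.
pose r := (1 + e^-1) / (2 * rho * c).
have r0 : 0 < r by rewrite divr_gt0 ?mulr_gt0// addr_gt0// invr_gt0.
(* [good] measures frequencies in the Euclidean norm, the decay estimate in the sup norm; the factor
   converts one into the other and stays positive for every [d]. *)
exists ((d%:R + 1) * r); first by rewrite mulr_gt0.
move=> xi hxi.
have rxi : r <= `|xi|.
  rewrite leNgt; apply/negP => xir; move: hxi; apply/negP; rewrite -ltNge.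
  apply: le_lt_trans (enorm_le _) _.
  apply: le_lt_trans (_ : d%:R * r < _); first by rewrite ler_wpM2l// ltW.
  by rewrite ltr_pM2r// ltrDl.
apply: hmu => psi.
pose I (p : J) := \int[leb]_(t in `[0, 1]) cos (2 * pi * dotp xi ((rs p).2 t) + psi).
change (\sum_p I p <= #|{: J}|%:R * (1 / N%:R + delta)).
have I1 p : I p <= 1.
  have ci : continuous (fun t => cos (2 * pi * dotp xi ((rs p).2 t) + psi)).
    move=> t; apply: continuous_comp; last exact: continuous_cos.
    by apply: cvgD; [exact: dotp_curve_continuous|exact: cvg_cst].
  by have := Rintegral_itv_le ler01 ci (fun t _ => cos_le1 _); rewrite subr0 mulr1.
pose B := [pred p : J | `|dotp xi (v p)| < c * `|xi|].
have Ie p : ~~ B p -> I p <= 2 * e.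
  rewrite /= -leNgt => xiv; have [rp0 cs _ hs] := hrs p.
  apply: (@curve_decay _ (v p) _ (rs p).1 k c) => //.
  move: rxi; rewrite ler_pdivrMr; last by rewrite !mulr_gt0.
  move=> h; apply: le_trans h _; rewrite mulrC ler_wpM2r//.
  by apply: ler_wpM2r; [exact: ltW|rewrite ler_pM2l].
rewrite (bigID B) /=.
apply: le_trans (_ : (m + N * d)%:R + (N * m)%:R * (2 * e) <= _).
  apply: lerD.
    apply: le_trans (_ : #|B|%:R <= _); last by rewrite ler_nat; exact: hc.
    by rewrite -sum1_card natr_sum; apply: ler_sum => p _; exact: I1.
  apply: le_trans (_ : \sum_(p | ~~ B p) (2 * e) <= _).
    by apply: ler_sum => p pB; exact: Ie.
  rewrite sumr_const.
  rewrite -[leLHS]mulr_natl; apply: ler_wpM2r; first by rewrite mulr_ge0// ltW.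
  by rewrite ler_nat -cardJ max_card.
rewrite cardJ !natrD !natrM /e.
have N0R : 0 < N%:R :> R by rewrite ltr0n.
have -> : N%:R * m%:R * (1 / N%:R + delta) =
   m%:R + N%:R * (m%:R * (delta / 2)) + N%:R * m%:R * (2 * (delta / 4)).
  by field; rewrite gt_eqF.
by rewrite lerD2r lerD2l ler_wpM2l.
Qed.

End good_measures.

(** * The gauge and its points of strict differentiability *)

Lemma convex_setP (R : realType) (V : lmodType R) (K : set V) :
  convex_set K <-> forall x y (t : R), 0 <= t -> t <= 1 -> K x -> K y ->
    K (t *: x + (1 - t) *: y).
Proof.
split=> [cK x y t t0 t1 Kx Ky|h x y l].
  have t01 : t \in `[0, 1] by rewrite in_itv/= t0.
  have := cK x y (Itv01 t0 t1); rewrite !inE; exact.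
rewrite !inE => Kx Ky.
by apply: (h x y l%:num).
Qed.

Section gauge.
Variables (R : realType) (V : normedModType R) (K : set V) (r M : R).

Definition gauge (x : V) : R := inf [set l | 0 < l /\ K (l^-1 *: x)].

Hypothesis cK : convex_set K.
Hypothesis closedK : closed K.
Hypothesis symK : forall x, K x -> K (- x).
Hypothesis r0 : 0 < r.
Hypothesis ballK : forall x, `|x| < r -> K x.
Hypothesis boundK : forall x, K x -> `|x| <= M.

Let K0 : K 0. Proof. by apply: ballK; rewrite normr0. Qed.

Let scaleK x t : 0 <= t -> t <= 1 -> K x -> K (t *: x).
Proof.
move=> t0 t1 Kx; have := (convex_setP K).1 cK x 0 t t0 t1 Kx K0.
by rewrite scaler0 addr0.
Qed.

Let limK z : (forall t, 0 < t -> t < 1 -> K (t *: z)) -> K z.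
Proof.
move=> h; apply: closedK => U /nbhs_ballP[e /= e0 eU].
have z1 : 0 < `|z| + 1 by rewrite ltr_wpDl.
pose s := Num.min (1 / 2) (e / 2 / (`|z| + 1)).
have s0 : 0 < s by rewrite lt_min !divr_gt0.
have s1 : s <= 1 / 2 by rewrite ge_min lexx.
have se : s <= e / 2 / (`|z| + 1) by rewrite ge_min lexx orbT.
exists ((1 - s) *: z); split; first by apply: h; lra.
apply: eU; rewrite -ball_normE /= scalerBl scale1r opprB addrC subrK normrZ.
rewrite gtr0_norm//; apply: le_lt_trans (_ : s * (`|z| + 1) < _).
  by rewrite ler_wpM2l ?lerDl// ltW.
by move: se; rewrite ler_pdivlMr// => se; lra.
Qed.

Let S x := [set l | 0 < l /\ K (l^-1 *: x)].

Let lbS x : lbound (S x) 0. Proof. by move=> l [/ltW]. Qed.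

Let SC x l : `|x| / r < l -> S x l.
Proof.
move=> xl; have l0 : 0 < l by apply: le_lt_trans xl; rewrite divr_ge0// ltW.
split => //; apply: ballK.
by rewrite normrZ normfV (gtr0_norm l0) mulrC ltr_pdivrMr// mulrC -ltr_pdivrMr.
Qed.

Let infS x : has_inf (S x).
Proof.
split; last by exists 0; exact: lbS.
by exists (`|x| / r + 1); apply: SC; rewrite ltrDl.
Qed.

(** Since [K] is closed, membership passes to the radial limit, so the infimum is attained. *)
Lemma gauge_leP x l : 0 < l -> (gauge x <= l) <-> K (l^-1 *: x).
Proof.
move=> l0; split=> [xl|Kl]; last by apply: ge_inf; [exact: (infS x).2|].
apply: limK => t t0 t1.
have tl : gauge x < l / t.
  by apply: le_lt_trans xl _; rewrite ltr_pdivlMr// gtr_pMr.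
have := inf_lt (infS x).1 tl; move=> [l' [l'0 Kl'] l't].
have -> : t *: (l^-1 *: x) = (t * l^-1 * l') *: (l'^-1 *: x).
  by rewrite !scalerA -mulrA mulfV ?mulr1// gt_eqF.
apply: scaleK => //; first by rewrite !mulr_ge0// ?invr_ge0 ltW.
rewrite mulrC mulrA ler_pdivrMr// mul1r ltW//.
by move: l't; rewrite ltr_pdivlMr.
Qed.

Lemma gauge_ge0 x : 0 <= gauge x.
Proof. by apply: lb_le_inf; [exact: (infS x).1|exact: lbS]. Qed.

Lemma gauge_le1 x : gauge x <= 1 <-> K x.
Proof. by rewrite gauge_leP// invr1 scale1r. Qed.

Lemma gauge_norm x : gauge x <= r^-1 * `|x|.
Proof.
apply/ler_addgt0Pr => e e0; apply: ge_inf; first exact: (infS x).2.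
by apply: SC; rewrite mulrC ltrDl.
Qed.

Lemma norm_gauge x : `|x| <= M * gauge x.
Proof.
have M0 : 0 <= M by rewrite -(normr0 V); exact: boundK.
have h l : 0 < l -> gauge x <= l -> `|x| <= M * l.
  move=> l0 /(gauge_leP _ l0).1 /boundK.
  by rewrite normrZ normfV (gtr0_norm l0) mulrC ler_pdivrMr.
apply/ler_addgt0Pr => e e0.
have M1 : 0 < M + 1 by lra.
have e1 : 0 < e / (M + 1) by rewrite divr_gt0.
have g0 := gauge_ge0 x.
apply: le_trans (h (gauge x + e / (M + 1)) _ _) _; [lra|lra|].
rewrite mulrDr lerD2l mulrA ler_pdivrMr// mulrC ler_pM2l//; lra.
Qed.

Lemma gaugeD x y : gauge (x + y) <= gauge x + gauge y.
Proof.
apply/ler_addgt0Pr => e e0.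
have gx := gauge_ge0 x; have gy := gauge_ge0 y.
pose l := gauge x + e / 2; pose l' := gauge y + e / 2.
have l0 : 0 < l by rewrite /l; lra.
have l'0 : 0 < l' by rewrite /l'; lra.
have -> : gauge x + gauge y + e = l + l' by rewrite /l /l'; lra.
have ll0 : 0 < l + l' by lra.
apply/gauge_leP => //.
have Kx : K (l^-1 *: x) by apply/gauge_leP => //; rewrite /l; lra.
have Ky : K (l'^-1 *: y) by apply/gauge_leP => //; rewrite /l'; lra.
have := (convex_setP K).1 cK _ _ (l / (l + l')) _ _ Kx Ky.
rewrite !scalerA mulrAC mulfV ?gt_eqF// mul1r.
have -> : (1 - l / (l + l')) * l'^-1 = (l + l')^-1 by field; rewrite !gt_eqF.
rewrite -scalerDr; apply; first by rewrite divr_ge0// ltW.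
by rewrite ler_pdivrMr// mul1r lerDl ltW.
Qed.

Lemma gauge0 : gauge 0 = 0.
Proof.
apply/eqP; rewrite eq_le gauge_ge0 andbT.
by have := gauge_norm 0; rewrite normr0 mulr0.
Qed.

Let gaugeZ_le a x : 0 < a -> gauge (a *: x) <= a * gauge x.
Proof.
move=> a0; apply/ler_addgt0Pr => e e0.
have g0 := gauge_ge0 x; have ea : 0 < e / a by rewrite divr_gt0.
have -> : a * gauge x + e = a * (gauge x + e / a).
  by rewrite mulrDr mulrCA divff ?mulr1// gt_eqF.
have l0 : 0 < gauge x + e / a by lra.
apply/gauge_leP; first exact: mulr_gt0.
rewrite scalerA invfM mulrAC mulVf ?gt_eqF// mul1r.
by apply/gauge_leP => //; lra.
Qed.

Lemma gaugeZ a x : 0 <= a -> gauge (a *: x) = a * gauge x.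
Proof.
rewrite le_eqVlt => /predU1P[<-|a0]; first by rewrite scale0r mul0r gauge0.
apply/eqP; rewrite eq_le gaugeZ_le//=.
have an0 : a != 0 by rewrite gt_eqF.
rewrite -ler_pdivlMl// -{1}[x](scalerK an0).
by apply: gaugeZ_le; rewrite invr_gt0.
Qed.

Lemma gaugeN x : gauge (- x) = gauge x.
Proof.
have h y : gauge (- y) <= gauge y.
  apply/ler_addgt0Pr => e e0; have g0 := gauge_ge0 y.
  have l0 : 0 < gauge y + e by lra.
  apply/gauge_leP => //; rewrite scalerN; apply: symK.
  by apply/gauge_leP => //; lra.
by apply/eqP; rewrite eq_le h/= -{1}[x]opprK h.
Qed.

Lemma gauge_lip x y : `|gauge x - gauge y| <= r^-1 * `|x - y|.
Proof.
have h x' y' : gauge x' - gauge y' <= r^-1 * `|x' - y'|.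
  have := gaugeD (x' - y') y'; rewrite subrK.
  by have := gauge_norm (x' - y'); lra.
by rewrite ler_norml; have := h x y; have := h y x; rewrite (distrC y); lra.
Qed.

Lemma gauge_eq0 x : gauge x = 0 -> x = 0.
Proof. by move=> g0; have := norm_gauge x; rewrite g0 mulr0 normr_le0 => /eqP. Qed.

Lemma gauge_gt0 x : x != 0 -> 0 < gauge x.
Proof.
move=> x0; rewrite lt_def gauge_ge0 andbT.
by apply: contra x0 => /eqP /gauge_eq0 ->.
Qed.

Lemma gauge_continuous : continuous gauge.
Proof.
by apply: lipschitz_continuous gauge_lip; rewrite invr_ge0 ltW.
Qed.

(** Points of gauge below 1 are interior by continuity; a point of gauge 1 leaves [K] as soon as it
    is scaled up. *)
Lemma boundary_gauge : boundary K = [set x | gauge x = 1].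
Proof.
rewrite /boundary -(closure_id K).1//; apply/seteqP; split => x /=.
  move=> [Kx nI]; apply/eqP; rewrite eq_le; apply/andP; split; first exact/gauge_le1.
  rewrite leNgt; apply/negP => x1; apply: nI; rewrite /interior /=.
  have /cvgrPdist_lt/(_ (1 - gauge x)) := @gauge_continuous x.
  rewrite subr_gt0 => /(_ x1); apply: filterS => y.
  by rewrite ltr_distl => /andP[h _]; apply/gauge_le1; lra.
move=> x1; split; first by apply/gauge_le1; rewrite x1.
move=> /nbhs_ballP[e /= e0 eK].
have xn : 0 < `|x| + 1 by rewrite ltr_wpDl.
pose s := e / 2 / (`|x| + 1).
have s0 : 0 < s by rewrite !divr_gt0.
have : K ((1 + s) *: x).
  apply: eK; rewrite -ball_normE /= scalerDl scale1r opprD addrA subrr sub0r normrN.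
  rewrite normrZ gtr0_norm//; apply: le_lt_trans (_ : s * (`|x| + 1) < _).
    by rewrite ler_wpM2l ?lerDl// ltW.
  by rewrite /s divfK ?gt_eqF//; lra.
by move/gauge_le1; rewrite gaugeZ ?x1; lra.
Qed.

End gauge.

(** Both [y] and [y'] vary: [f - dotp q] has arbitrarily small Lipschitz constants on small balls
    around [x]. This two-point form is what straightness of curves in a level set requires. *)
Definition strict_diff (R : realType) (d : nat) (f : 'rV[R]_d -> R)
    (x q : 'rV[R]_d) : Prop :=
  forall k, 0 < k -> exists2 r, 0 < r & forall y y', `|y - x| < r -> `|y' - x| < r ->
    `|f y - f y' - dotp q (y - y')| <= k * `|y - y'|.

Section strict_diff_dense.
Variables (R : realType) (d : nat) (f : 'rV[R]_d -> R) (L : R).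
Hypothesis L0 : 0 <= L.
Hypothesis lipf : forall x y, `|f x - f y| <= L * `|x - y|.
Hypothesis convf : forall x y t, 0 <= t -> t <= 1 ->
  f (t *: x + (1 - t) *: y) <= t * f x + (1 - t) * f y.
Implicit Types (x y e : 'rV[R]_d).

Let slope_nondecr y e s0 s : 0 < s0 -> 0 < s ->
  (f y - f (y - s0 *: e)) / s0 <= (f (y + s *: e) - f y) / s.
Proof.
move=> s00 sp; have ss : 0 < s + s0 by lra.
have t0 : 0 <= s / (s + s0) by rewrite divr_ge0// ltW.
have t1 : s / (s + s0) <= 1 by rewrite ler_pdivrMr// mul1r lerDl ltW.
have := @convf (y - s0 *: e) (y + s *: e) (s / (s + s0)).
have -> : s / (s + s0) *: (y - s0 *: e) + (1 - s / (s + s0)) *: (y + s *: e) = y.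
  have -> : 1 - s / (s + s0) = s0 / (s + s0) by field; rewrite gt_eqF.
  apply/rowP => i; rewrite !mxE; field; by rewrite gt_eqF.
move=> /(_ t0 t1).
have -> : 1 - s / (s + s0) = s0 / (s + s0) by field; rewrite gt_eqF.
rewrite (_ : _ + _ = (s * f (y - s0 *: e) + s0 * f (y + s *: e)) / (s + s0));
  last by field; rewrite gt_eqF.
rewrite ler_pdivlMr// => h.
by rewrite ler_pdivrMr// mulrAC ler_pdivlMr//; lra.
Qed.

Definition chord_slope x r k e a := forall y s, `|y - x| < r ->
  `|y + s *: e - x| < r -> `|f (y + s *: e) - f y - a * s| <= k * `|s|.

Lemma chord_slope_sub x r x' r' k e a : `|x' - x| + r' <= r ->
  chord_slope x r k e a -> chord_slope x' r' k e a.
Proof.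
move=> xr h y s y1 y2; apply: h.
  by have := ler_distD x' y x; lra.
by have := ler_distD x' (y + s *: e) x; lra.
Qed.

(* Past the end of a chord whose slope is almost the supremum [q] of the slopes,
   convexity keeps all slopes within [k] of [q]. *)
Lemma exists_chord_slope x r k e : 0 < r -> 0 < k -> `|e| <= 1 ->
  exists x' r' a, [/\ 0 < r', `|x' - x| + r' <= r & chord_slope x' r' k e a].
Proof.
move=> r0 k0 e1.
pose S := [set q | exists y s, [/\ 0 < s, `|y - x| < r, `|y + s *: e - x| < r &
   q = (f (y + s *: e) - f y) / s]].
have ubS : ubound S L.
  move=> _ [y [s [s0 _ _ ->]]]; rewrite ler_pdivrMr//.
  apply: le_trans (ler_norm _) _; apply: le_trans (lipf _ _) _.
  rewrite addrAC subrr add0r normrZ gtr0_norm// ler_wpM2l//.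
  by rewrite -[leRHS]mulr1 ler_wpM2l// ltW.
have S0 : S !=set0.
  exists ((f (x + (r / 2) *: e) - f x) / (r / 2)), x, (r / 2).
  have r2 : 0 < r / 2 by lra.
  split => //; first by rewrite subrr normr0.
  rewrite addrAC subrr add0r normrZ gtr0_norm//.
  have : r / 2 * `|e| <= r / 2 * 1 by rewrite ler_wpM2l// ltW.
  lra.
have supS : has_sup S by split => //; exists L.
pose q := sup S.
have [_ [y0 [s0 [s00 y1 y2 ->]]]] := sup_adherent k0 supS.
rewrite -/q => gap.
set g := (f (y0 + s0 *: e) - f y0) / s0 in gap.
have L1 : 0 < 2 * (L + 1) by rewrite mulr_gt0// ltr_wpDl.
(* Translating the chord by less than [dl] changes its slope by at most [2 * L * dl / s0], which is
   within the margin [g - (q - k)]; [L + 1] avoids dividing by 0. *)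
pose dl := (g - (q - k)) * s0 / (2 * (L + 1)).
have dl0 : 0 < dl by rewrite divr_gt0// mulr_gt0//; lra.
pose x' := y0 + s0 *: e.
have rx : 0 < r - `|x' - x| by rewrite subr_gt0.
exists x', (Num.min dl (r - `|x' - x|)), q; split.
- by rewrite lt_min dl0.
- have : Num.min dl (r - `|x' - x|) <= r - `|x' - x| by rewrite ge_min lexx orbT.
  lra.
have main y s : 0 < s -> `|y - x'| < dl -> `|y - x'| < r - `|x' - x| ->
    `|y + s *: e - x'| < r - `|x' - x| ->
    `|f (y + s *: e) - f y - q * s| <= k * s.
  move=> sp ydl yr ysr.
  have up : (f (y + s *: e) - f y) / s <= q.
    apply: ub_le_sup; first exact: supS.2.
    exists y, s; split=> //.
      by have := ler_distD x' y x; lra.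
    by have := ler_distD x' (y + s *: e) x; lra.
  have lo : q - k <= (f (y + s *: e) - f y) / s.
    apply: le_trans (slope_nondecr y e s00 sp).
    rewrite ler_pdivlMr//.
    have h1 := lipf y x'; have h2 := lipf (y - s0 *: e) y0.
    rewrite (_ : y - s0 *: e - y0 = y - x') in h2; last first.
      by rewrite /x' opprD addrA addrAC.
    have Ldl : L * `|y - x'| <= (L + 1) * dl.
      by apply: ler_pM => //; lra.
    have gE : g * s0 = f x' - f y0 by rewrite /g divfK// gt_eqF.
    have dlE : 2 * ((L + 1) * dl) = (g - (q - k)) * s0.
      by rewrite mulrA /dl mulrC divfK// gt_eqF.
    move: h1 h2; rewrite !ler_norml => /andP[h1 _] /andP[_ h2]; lra.
  rewrite ler_pdivrMr// in up; rewrite ler_pdivlMr// in lo.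
  by rewrite ler_norml; apply/andP; split; lra.
move=> y s; rewrite !lt_min => /andP[y1' y2'] /andP[y3' y4'].
have [sn|sp|->] := ltgtP s 0; last first.
- by rewrite scale0r addr0 mulr0 subrr subr0 !normr0 mulr0.
- by rewrite (gtr0_norm sp); apply: main.
have := main (y + s *: e) (- s); rewrite scaleNr addrK oppr_gt0 => /(_ sn y3' y4' y2').
by rewrite (ltr0_norm sn) -normrN; congr (`|_| <= _); lra.
Qed.

Definition almost_linear x r k a := forall y y', `|y - x| < r -> `|y' - x| < r ->
  `|f y - f y' - dotp a (y - y')| <= k * `|y - y'|.

Lemma delta_norm (j : 'I_d) : `|delta_mx ord0 j : 'rV[R]_d| <= 1.
Proof.
apply: norm_le_coord => // i; rewrite mxE.
by case: (_ && _); rewrite ?normr1 ?normr0.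
Qed.

(** The path from [y'] to [y] changes one coordinate at a time. Balls of the sup norm are boxes, so
    all corners of the path stay in the ball; each of the [d] steps costs at most [k * |y - y'|]. *)
Lemma chord_slope_almost_linear x r k (a : 'rV[R]_d) : 0 <= k ->
  (forall j, chord_slope x r k (delta_mx ord0 j) (a ord0 j)) ->
  almost_linear x r (d%:R * k) a.
Proof.
move=> k0 ha y y' yr y'r.
pose z (i : nat) : 'rV[R]_d := \row_j if (j < i)%N then y ord0 j else y' ord0 j.
have zr i : `|z i - x| < r.
  apply: le_lt_trans (_ : Num.max `|y - x| `|y' - x| < r); last by rewrite gt_max yr.
  apply: norm_le_coord => [|j]; first by rewrite le_max normr_ge0.
  rewrite !mxE le_max; case: ifP => _.
    by have := coord_le_norm (y - x) j; rewrite !mxE => ->.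
  by have := coord_le_norm (y' - x) j; rewrite !mxE => ->; rewrite orbT.
have step (i : nat) : (i <= d)%N -> `|f (z i) - f y' -
    \sum_(j < d | (j < i)%N) a ord0 j * (y - y') ord0 j| <= i%:R * k * `|y - y'|.
  elim: i => [_|i IH id].
    rewrite big_pred0_eq (_ : z 0%N = y') ?subrr ?subr0 ?normr0 ?mul0r//.
    by apply/rowP => j; rewrite mxE.
  pose io := Ordinal id.
  have zE : z i.+1 = z i + (y - y') ord0 io *: delta_mx ord0 io.
    apply/rowP => j; rewrite !mxE eqxx /= ltnS leq_eqVlt.
    have [->|ji] := eqVneq j io; first by rewrite /= eqxx ltnn /= mulr1; lra.
    by rewrite mulr0 addr0 -(inj_eq val_inj) /= in ji *; rewrite (negPf ji).
  have := ha io (z i) ((y - y') ord0 io) (zr i); rewrite -zE => /(_ (zr _)) h.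
  rewrite (bigD1 io) //=.
  have -> : \sum_(j < d | (j < i.+1)%N && (j != io)) a ord0 j * (y - y') ord0 j =
      \sum_(j < d | (j < i)%N) a ord0 j * (y - y') ord0 j.
    apply: eq_bigl => j; rewrite ltnS leq_eqVlt -(inj_eq val_inj) /=.
    by case: (ltngtP j i).
  have h' := IH (ltnW id).
  have h2 : k * `|(y - y') ord0 io| <= k * `|y - y'|.
    by rewrite ler_wpM2l// coord_le_norm.
  rewrite -natr1 !mulrDl mul1r.
  rewrite (_ : _ - _ - _ = (f (z i.+1) - f (z i) - a ord0 io * (y - y') ord0 io) +
    (f (z i) - f y' - \sum_(j < d | (j < i)%N) a ord0 j * (y - y') ord0 j)); last by ring.
  by apply: le_trans (ler_normD _ _) _; lra.
have := step d (leqnn d); rewrite (_ : z d = y); last first.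
  by apply/rowP => j; rewrite mxE ltn_ord.
by rewrite (eq_bigl xpredT) // => j; rewrite ltn_ord.
Qed.

(** The coordinate directions are treated in turn, each on a smaller ball inside the previous one,
    where the slopes already found remain valid. *)
Lemma exists_almost_linear x r k : 0 < r -> 0 < k ->
  exists x' r' a, [/\ 0 < r', `|x' - x| + r' <= r & almost_linear x' r' k a].
Proof.
move=> r0 k0.
have d1 : 0 < d%:R + 1 :> R by rewrite ltr_wpDl.
pose k' := k / (d%:R + 1); have k'0 : 0 < k' by rewrite divr_gt0.
suff [x' [r' [a [r'0 xr h]]]] : exists x' r' (a : 'rV[R]_d),
    [/\ 0 < r', `|x' - x| + r' <= r &
        forall j, chord_slope x' r' k' (delta_mx ord0 j) (a ord0 j)].
  exists x', r', a; split => // y y' yr y'r.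
  apply: le_trans (chord_slope_almost_linear (ltW k'0) h yr y'r) _.
  rewrite ler_wpM2r//; apply: le_trans (_ : (d%:R + 1) * k' <= _).
    by rewrite ler_wpM2r ?lerDl// ltW.
  by rewrite mulrC divfK// gt_eqF.
suff /(_ d) [x' [r' [a [r'0 xr h]]]] : forall n, exists x' r' (a : 'rV[R]_d),
    [/\ 0 < r', `|x' - x| + r' <= r & forall j : 'I_d, (j < n)%N ->
       chord_slope x' r' k' (delta_mx ord0 j) (a ord0 j)].
  by exists x', r', a; split => // j; apply: h; exact: ltn_ord.
elim=> [|n [x1 [r1 [a1 [r10 xr1 h1]]]]].
  by exists x, r, 0; split => //; rewrite subrr normr0 add0r.
have [nd|nd] := ltnP n d; last first.
  exists x1, r1, a1; split => // j _; apply: h1; exact: leq_trans (ltn_ord j) nd.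
have [x2 [r2 [b [r20 xr2 h2]]]] :=
  @exists_chord_slope x1 r1 k' _ r10 k'0 (delta_norm (Ordinal nd)).
exists x2, r2, (\row_j if j == Ordinal nd then b else a1 ord0 j); split => //.
  by have := ler_distD x1 x2 x; lra.
move=> j; rewrite mxE; have [-> _|jn] := eqVneq j (Ordinal nd); first exact: h2.
rewrite ltnS leq_eqVlt; rewrite -(inj_eq val_inj) /= in jn.
by rewrite (negPf jn) /= => ji; exact: chord_slope_sub xr2 (h1 j ji).
Qed.

Lemma strict_diff_dense x r : 0 < r ->
  exists x' q, `|x' - x| < r /\ strict_diff f x' q.
Proof.
move=> r0.
(* Each [O n] is open because its condition concerns a whole ball, and dense by
   [exists_almost_linear]; a point lying in all of them is a point of strict differentiability. *)
pose O (n : nat) := [set z | exists r a, 0 < r /\ almost_linear z r n.+1%:R^-1 a].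
have OP n : open (O n) /\ dense (O n).
  split.
    rewrite openE => z [s [a [s0 h]]]; apply/nbhs_ballP; exists (s / 2) => /=.
      by rewrite divr_gt0.
    move=> w; rewrite -ball_normE /= => zw; exists (s / 2), a; split.
      by rewrite divr_gt0.
    move=> y y' yw y'w; rewrite distrC in zw; apply: h.
      by have := ler_distD w y z; lra.
    by have := ler_distD w y' z; lra.
  move=> U [z Uz] oU.
  have /nbhs_ballP[s /= s0 sU] : nbhs z U by exact: open_nbhs_nbhs.
  have [x' [r' [a [r'0 xr h]]]] := @exists_almost_linear z s n.+1%:R^-1 s0 ltac:(by []).
  exists x'; split; last by exists r', a.
  by apply: sU; rewrite -ball_normE /= distrC; lra.
have bx : ball x r !=set0 by exists x; exact: ballxx.
have [x' [+ Ox']] := @Baire R 'rV[R]_d O OP _ bx (ball_open x r).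
rewrite -ball_normE /= distrC => x'r; exists x'.
have /choice[ra hra] : forall n, exists ra : R * 'rV[R]_d,
    0 < ra.1 /\ almost_linear x' ra.1 n.+1%:R^-1 ra.2.
  by move=> n; have [s [a h]] := Ox' n I; exists (s, a).
pose kk (n : nat) : R := n.+1%:R^-1.
(* Two approximate slopes at the same point both describe one and the same short step along
   coordinate [j], so they differ by at most the sum of their errors. *)
have cmp n m j : (ra n).2 ord0 j - kk n <= (ra m).2 ord0 j + kk m.
  have [rn hn] := hra n; have [rm hm] := hra m.
  pose s := Num.min (ra n).1 (ra m).1 / 2.
  have s0 : 0 < s by rewrite divr_gt0// lt_min rn.
  have sn : s < (ra n).1.
    have : Num.min (ra n).1 (ra m).1 <= (ra n).1 by rewrite ge_min lexx.
    rewrite /s in s0 *; lra.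
  have sm : s < (ra m).1.
    have : Num.min (ra n).1 (ra m).1 <= (ra m).1 by rewrite ge_min lexx orbT.
    rewrite /s in s0 *; lra.
  pose y := x' + s *: delta_mx ord0 j.
  have yx : y - x' = s *: delta_mx ord0 j by rewrite /y addrAC subrr add0r.
  have ys : `|y - x'| <= s.
    by rewrite yx normrZ gtr0_norm// -[leRHS]mulr1 ler_wpM2l ?delta_norm// ltW.
  have := hn y x' (le_lt_trans ys sn); rewrite subrr normr0 => /(_ rn).
  have := hm y x' (le_lt_trans ys sm); rewrite subrr normr0 => /(_ rm).
  rewrite yx !dotpZr !dotp_delta -yx -/(kk n) -/(kk m).
  have kn0 : 0 <= kk n by rewrite /kk invr_ge0.
  have km0 : 0 <= kk m by rewrite /kk invr_ge0.
  move=> h1 h2; rewrite -(ler_pM2l s0).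
  have h3 : kk n * `|y - x'| <= s * kk n by rewrite mulrC ler_wpM2r.
  have h4 : kk m * `|y - x'| <= s * kk m by rewrite mulrC ler_wpM2r.
  move: h1 h2; rewrite !ler_norml => /andP[_ h1] /andP[h2 _]; lra.
(* The limit of the slopes [(ra n).2], written as a supremum. *)
pose q : 'rV[R]_d := \row_j sup [set (ra n).2 ord0 j - kk n | n in setT].
exists q; split => // k k0.
have qE n j : `|((ra n).2 - q) ord0 j| <= kk n.
  rewrite !mxE ler_distl; apply/andP; split.
    rewrite lerBlDr; apply: ge_sup.
      by exists ((ra 0).2 ord0 j - kk 0); exists 0%N.
    by move=> _ [m _ <-]; exact: cmp.
  rewrite -lerBlDr; apply: ub_le_sup; last by exists n.
  by exists ((ra 0).2 ord0 j + kk 0) => _ [m _ <-]; exact: cmp.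
have d1 : 0 < d%:R + 1 :> R by rewrite ltr_wpDl.
pose n := Num.truncn ((d%:R + 1) / k).
have nk : (d%:R + 1) * kk n <= k.
  have := ltW (truncnS_gt ((d%:R + 1) / k)); rewrite -/n ler_pdivrMr// => h.
  by rewrite ler_pdivrMr// mulrC.
have [rn hn] := hra n; exists (ra n).1 => // y y' yr y'r.
have h1 := hn y y' yr y'r; rewrite -/(kk n) in h1.
have h2 : `|dotp ((ra n).2 - q) (y - y')| <= d%:R * kk n * `|y - y'|.
  apply: le_trans (normr_dotp _ _) _; rewrite ler_wpM2r// ler_wpM2l//.
  by apply: norm_le_coord; [rewrite /kk invr_ge0|exact: qE].
apply: le_trans (_ : (d%:R + 1) * kk n * `|y - y'| <= _); last by rewrite ler_wpM2r.
rewrite dotpBl in h2.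
rewrite (_ : _ - _ - _ = (f y - f y' - dotp (ra n).2 (y - y')) +
  (dotp (ra n).2 (y - y') - dotp q (y - y'))); last by ring.
apply: le_trans (ler_normD _ _) _; lra.
Qed.

End strict_diff_dense.

(** Clipping the parameter to [[0, 1]] makes the curve total, and its continuity comes for free,
    since the chord estimate already bounds its Lipschitz constant. *)
Lemma almost_flatI (R : realType) (d : nat) (A : set 'rV[R]_d) (q : 'rV[R]_d) :
  (forall (v : 'rV[R]_d) (k : R), dotp q v = 0 -> 0 < k ->
    exists (rho : R) (s : R -> 'rV[R]_d),
      [/\ 0 < rho, forall t, t \in `[0, 1] -> A (s t) &
        forall t t', t \in `[0, 1] -> t' \in `[0, 1] ->
          `|s t - s t' - ((t - t') * rho) *: v| <= k * rho * `|t - t'|]) ->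
  almost_flat A q.
Proof.
move=> h v k qv k0; have [rho [s [rho0 As hs]]] := h v k qv k0.
pose c (t : R) := Num.max 0 (Num.min t 1).
have c01 t : c t \in `[0, 1].
  by rewrite in_itv/= /c le_max lexx /= ge_max ler01 ge_min lexx orbT.
have cid t : t \in `[0, 1] -> c t = t.
  by rewrite in_itv/= => /andP[t0 t1]; rewrite /c min_l// max_r.
have clip t t' : `|c t - c t'| <= `|t - t'|.
  rewrite /c !minEle !maxEle; do ! case: ifP => //; move=> *; rewrite ler_norml;
    apply/andP; split; have := ler_norm (t - t'); have := ler_norm (t' - t);
    rewrite (distrC t'); lra.
exists rho, (s \o c); split => //=; last first.
- by move=> t t' t01 t01'; rewrite !cid//; exact: hs.
- by move=> t; exact: As.
apply: (@lipschitz_continuous _ _ _ _ (k * rho + rho * `|v|)).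
  by rewrite addr_ge0// mulr_ge0// ltW.
move=> t t' /=; have h1 := hs _ _ (c01 t) (c01 t').
apply: le_trans (_ : (k * rho + rho * `|v|) * `|c t - c t'| <= _); last first.
  by rewrite ler_wpM2l// addr_ge0// mulr_ge0// ltW.
rewrite -(subrK (((c t - c t') * rho) *: v) (s (c t) - s (c t'))).
apply: le_trans (ler_normD _ _) _.
by rewrite [leRHS]mulrDl; apply: lerD => //; rewrite normrZ normrM (gtr0_norm rho0); lra.
Qed.

(** * Gradients of a norm and nearly straight curves on its unit sphere *)

Section gradients.
Variables (R : realType) (d : nat) (n : 'rV[R]_d -> R) (L : R).
Hypothesis L0 : 0 < L.
Hypothesis nL : forall x, n x <= L * `|x|.
Hypothesis nD : forall x y, n (x + y) <= n x + n y.
Hypothesis nZ : forall a x, 0 <= a -> n (a *: x) = a * n x.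
Hypothesis nN : forall x, n (- x) = n x.
Hypothesis n_gt0 : forall x, x != 0 -> 0 < n x.
Implicit Types (x y q v : 'rV[R]_d).

Let nlip x y : `|n x - n y| <= L * `|x - y|.
Proof.
have h x' y' : n x' - n y' <= L * `|x' - y'|.
  by have := nD (x' - y') y'; rewrite subrK; have := nL (x' - y'); lra.
by rewrite ler_norml; have := h x y; have := h y x; rewrite (distrC y); lra.
Qed.

Let strict_diff_dir x q y k : strict_diff n x q -> 0 < k ->
  exists2 t, 0 < t & t <= 1 /\ `|n (x + t *: y) - n x - t * dotp q y| <= t * k.
Proof.
move=> dq k0; have y1 : 0 < `|y| + 1 by rewrite ltr_wpDl.
have [|r r0 hr] := dq (k / (`|y| + 1)); first exact: divr_gt0.
pose t := Num.min 1 (r / 2 / (`|y| + 1)).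
have t0 : 0 < t by rewrite lt_min ltr01 !divr_gt0.
have t1 : t <= 1 by rewrite ge_min lexx.
have tr : t * (`|y| + 1) < r.
  apply: le_lt_trans (_ : r / 2 < r); last by lra.
  by rewrite -ler_pdivlMr// ge_min lexx orbT.
exists t => //; split => //.
have xy : x + t *: y - x = t *: y by rewrite addrAC subrr add0r.
have := hr (x + t *: y) x; rewrite xy subrr normr0 normrZ (gtr0_norm t0) dotpZr.
have ty : t * `|y| <= t * (`|y| + 1) by rewrite ler_wpM2l ?lerDl// ltW.
move=> /(_ (le_lt_trans ty tr) r0) h; apply: le_trans h _.
rewrite mulrCA ler_pM2l// mulrAC ler_pdivrMr// ler_pM2l// lerDl//.
Qed.

(** Subadditivity bounds the increment [n (x + t *: y) - n x] by [t * n y], and to first order it is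
    [t * dotp q y]. *)
Lemma strict_diff_le x q y : strict_diff n x q -> dotp q y <= n y.
Proof.
move=> dq; apply/ler_addgt0Pr => k k0.
have [t t0 [_ h]] := strict_diff_dir y dq k0.
have := nD x (t *: y); rewrite nZ; last exact: ltW.
move=> h2; rewrite -(ler_pM2l t0); move: h; rewrite ler_norml => /andP[h _]; lra.
Qed.

(** Euler's identity for a homogeneous function, read off in the direction [- x]. *)
Lemma strict_diff_eq x q : strict_diff n x q -> dotp q x = n x.
Proof.
move=> dq; apply/eqP; rewrite eq_le (strict_diff_le _ dq)/=.
apply/ler_addgt0Pr => k k0.
have [t t0 [t1 h]] := strict_diff_dir (- x) dq k0.
move: h; rewrite scalerN -{1}[x]scale1r -scalerBl nZ ?subr_ge0// dotpNr.
rewrite ler_norml => /andP[h _].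
by rewrite -(ler_pM2l t0); lra.
Qed.

(** A differentiable point admits a single supporting functional; the direction [p - q] gives
    [dotp (p - q) (p - q) <= 0]. *)
Lemma strict_diff_uniq x q p : strict_diff n x q ->
  (forall y, dotp p y <= n y) -> dotp p x = n x -> p = q.
Proof.
move=> dq hp px; apply/eqP; rewrite -subr_eq0 -dotpxx_eq0 eq_le dotpxx_ge0 andbT.
apply/ler_addgt0Pr => k k0; rewrite add0r.
have [t t0 [_ h]] := strict_diff_dir (p - q) dq k0.
have := hp (x + t *: (p - q)); rewrite dotpDr px dotpZr.
rewrite [dotp (p - q) (p - q)]dotpBl => h2; rewrite -(ler_pM2l t0).
move: h; rewrite ler_norml => /andP[_ h]; lra.
Qed.

Lemma strict_diffZ x q a : 0 < a -> strict_diff n x q -> strict_diff n (a *: x) q.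
Proof.
move=> a0 dq k k0; have [r r0 hr] := dq k k0.
exists (a * r); first exact: mulr_gt0.
have an0 : a != 0 by rewrite gt_eqF.
have E (z : 'rV[R]_d) : exists w, z = a *: w by exists (a^-1 *: z); rewrite scalerA divff// scale1r.
move=> y y'; have [w ->] := E y; have [w' ->] := E y'.
rewrite -!scalerBr !normrZ !(gtr0_norm a0) !ltr_pM2l// => wr w'r.
have -> : n (a *: w) - n (a *: w') - dotp q (a *: (w - w')) =
    a * (n w - n w' - dotp q (w - w')).
  by rewrite !nZ ?(ltW a0)// dotpZr; ring.
by rewrite normrM (gtr0_norm a0) mulrCA ler_pM2l//; exact: hr.
Qed.

(** At a point with [n x = 1] Euler's identity normalises [q] by [dotp q x = 1]. Thus
    [dotp q y <= 1] is a supporting half-space of the unit ball. *)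
Definition gradient q := exists2 x, n x = 1 & strict_diff n x q.

Lemma gradient_le q y : gradient q -> dotp q y <= n y.
Proof. by move=> [x _ dq]; exact: strict_diff_le dq. Qed.

Lemma gradient_neq0 q : gradient q -> q != 0.
Proof.
move=> [x x1 dq]; apply/eqP => q0.
by have := strict_diff_eq dq; rewrite q0 dotp0l x1 => /eqP; rewrite eq_sym oner_eq0.
Qed.

(** The gradient at a point [x] of strict differentiability near [y] has value [n x] at [x], and
    passing from [x] to [y] costs at most [2 * L * |x - y|]. Staying within [|y|] of [y] keeps [x]
    nonzero. Hence [n] is the supremum of its gradients. *)
Lemma gradient_dense y eta : y != 0 -> 0 < eta ->
  exists2 q, gradient q & n y - eta <= dotp q y.
Proof.
move=> y0 eta0.
have ny : 0 < `|y| by rewrite normr_gt0.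
pose r := Num.min `|y| (eta / (2 * L)).
have r0 : 0 < r by rewrite lt_min ny divr_gt0// mulr_gt0.
have convn x' y' t : 0 <= t -> t <= 1 ->
    n (t *: x' + (1 - t) *: y') <= t * n x' + (1 - t) * n y'.
  by move=> t0 t1; apply: le_trans (nD _ _) _; rewrite !nZ// subr_ge0.
have [x [q [xy dq]]] := strict_diff_dense (ltW L0) nlip convn y r0.
have x0 : x != 0.
  apply/eqP => x0; move: xy; rewrite x0 sub0r normrN lt_min ltxx//.
have nx := n_gt0 x0.
exists q.
  exists ((n x)^-1 *: x); first by rewrite nZ ?invr_ge0 ?ltW// mulVf// gt_eqF.
  by apply: strict_diffZ => //; rewrite invr_gt0.
have : L * `|x - y| <= eta / 2.
  apply: ltW; apply: lt_le_trans (_ : L * (eta / (2 * L)) <= _).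
    rewrite ltr_pM2l//; apply: lt_le_trans xy _.
    by rewrite ge_min lexx orbT.
  have -> : L * (eta / (2 * L)) = eta / 2 by field; rewrite gt_eqF.
  exact: lexx.
have := strict_diff_eq dq; have := strict_diff_le (x - y) dq.
have := nlip x y; have := nL (x - y).
rewrite dotpBr ler_norml => h1 /andP[h2 h3] h4 h5 h6; lra.
Qed.

(** Every gradient attains the value 1 on the unit sphere and never exceeds 1 there in absolute
    value, so a factor between two of them has modulus 1. *)
Lemma gradient_parallel q q' a : gradient q -> gradient q' -> q' = a *: q ->
  q' = q \/ q' = - q.
Proof.
move=> gq gq' q'E.
have h p p' b : gradient p -> gradient p' -> p' = b *: p -> 1 <= `|b|.
  move=> gp [x x1 dp'] p'E; have := strict_diff_eq dp'.
  rewrite p'E dotpZl x1 => <-; apply: le_trans (ler_norm _) _.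
  rewrite normrM -[leRHS]mulr1 ler_wpM2l// ler_norml.
  have := gradient_le x gp; have := gradient_le (- x) gp.
  by rewrite nN dotpNr x1; lra.
have a0 : a != 0.
  by apply/eqP => a0; have := h _ _ _ gq gq' q'E; rewrite a0 normr0 ler10.
have a1 := h _ _ _ gq gq' q'E.
have a2 : 1 <= `|a^-1|.
  by apply: h gq' gq _; rewrite q'E scalerA mulVf// scale1r.
have : `|a| = 1.
  apply/eqP; rewrite eq_le a1 andbT; move: a2; rewrite normfV.
  by rewrite -(ler_pM2l (_ : 0 < `|a|)) ?normr_gt0// mulr1 divff// normr_eq0.
rewrite q'E; have [ap|an] := leP 0 a.
  by rewrite ger0_norm// => ->; left; rewrite scale1r.
rewrite ltr0_norm// => /eqP; rewrite eqr_oppLR => /eqP ->; right.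
by rewrite scaleN1r.
Qed.

(** The curve is a short segment through [x] in the tangent direction [v], projected radially to the
    unit sphere. Since [dotp q v = 0], strict differentiability makes [n] nearly constant along the
    segment in the Lipschitz sense, so the projection hardly bends it. *)
Lemma gradient_almost_flat q : gradient q -> almost_flat [set x | n x = 1] q.
Proof.
move=> [x x1 dq]; apply: almost_flatI => v k qv k0.
have v1 : 0 < `|v| + 1 by rewrite ltr_wpDl.
(* [C - 1] collects the factors in the final estimate, [2 |v|^2 + 4 |v| (|x| + |v|)]. The other
   bound on [k'] keeps [n] at least [1 / 2] along the segment, so that inverses stay below 2. *)
pose C := `|v| * (6 * `|v| + 4 * `|x|) + 1.
have C0 : 0 < C by rewrite /C ltr_wpDl// mulr_ge0// addr_ge0// mulr_ge0.
pose k' := Num.min (1 / (2 * (`|v| + 1))) (k / C).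
have k'0 : 0 < k' by rewrite lt_min !divr_gt0// mulr_gt0.
have k'v : k' * (`|v| + 1) <= 1 / 2.
  rewrite -ler_pdivlMr//; have -> : 1 / 2 / (`|v| + 1) = 1 / (2 * (`|v| + 1)).
    by field; rewrite gt_eqF.
  by rewrite ge_min lexx.
have k'C : k' * C <= k by rewrite -ler_pdivlMr// ge_min lexx orbT.
have [r r0 hr] := dq k' k'0.
pose rho := Num.min 1 (r / (2 * (`|v| + 1))).
have rho0 : 0 < rho by rewrite lt_min ltr01 divr_gt0// mulr_gt0.
have rho1 : rho <= 1 by rewrite ge_min lexx.
have rhor : rho * (`|v| + 1) <= r / 2.
  rewrite -ler_pdivlMr//; have -> : r / 2 / (`|v| + 1) = r / (2 * (`|v| + 1)).
    by field; rewrite gt_eqF.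
  by rewrite ge_min lexx orbT.
pose p t := x + (t * rho) *: v.
have pp t t' : p t - p t' = ((t - t') * rho) *: v.
  by rewrite /p opprD addrACA subrr add0r -scalerBl mulrBl.
have px t : p t - x = (t * rho) *: v by rewrite /p addrAC subrr add0r.
have npx t : t \in `[0, 1] -> `|p t - x| <= rho * `|v|.
  rewrite in_itv/= => /andP[t0 t1]; rewrite px normrZ ger0_norm ?mulr_ge0 ?(ltW rho0)//.
  by rewrite -mulrA -[leRHS]mul1r ler_wpM2r// mulr_ge0// ltW.
have rv : rho * `|v| < r.
  by apply: le_lt_trans (_ : rho * (`|v| + 1) < r); [rewrite ler_wpM2l ?lerDl// ltW|lra].
have pr t : t \in `[0, 1] -> `|p t - x| < r.
  by move=> t01; exact: le_lt_trans (npx t t01) rv.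
have npp t t' : t \in `[0, 1] -> t' \in `[0, 1] ->
    `|n (p t) - n (p t')| <= k' * (rho * `|v| * `|t - t'|).
  move=> t01 t01'; have := hr _ _ (pr t t01) (pr t' t01').
  rewrite pp dotpZr qv mulr0 subr0 normrZ normrM (gtr0_norm rho0).
  by move=> h; apply: le_trans h _; rewrite ler_wpM2l ?(ltW k'0)//; lra.
have n1 t : t \in `[0, 1] -> `|n (p t) - 1| <= k' * (rho * `|v|).
  move=> t01; have := npp t 0 t01; rewrite in_itv/= lexx ler01 => /(_ erefl).
  rewrite {2}/p mul0r scale0r addr0 x1 subr0 => h; apply: le_trans h _.
  move: t01; rewrite in_itv/= => /andP[t0 t1].
  rewrite ler_pM2l// (ger0_norm t0) -[leRHS]mulr1 ler_wpM2l//.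
  by rewrite mulr_ge0// ltW.
have k'rv : k' * (rho * `|v|) <= 1 / 2.
  apply: le_trans k'v; rewrite ler_pM2l//.
  by apply: le_trans (_ : 1 * `|v| <= _); [rewrite ler_wpM2r|rewrite mul1r lerDl].
have n2 t : t \in `[0, 1] -> 1 / 2 <= n (p t).
  by move=> t01; have := n1 t t01; rewrite ler_norml => /andP[h _]; lra.
exists rho, (fun t => (n (p t))^-1 *: p t); split => //.
  move=> t /n2 h; rewrite /= nZ; first by rewrite mulVf// gt_eqF//; lra.
  by rewrite invr_ge0; lra.
move=> t t' t01 t01'; rewrite -pp.
have a1 := n1 t t01; have a2 := n2 t t01; have a3 := n2 t' t01'.
have a4 := npp t t' t01 t01'; have a5 := npx t' t01'.
set m := n (p t) in a1 a2 a4 *; set m' := n (p t') in a3 a4 *.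
have m0 : 0 < m by lra.
have m'0 : 0 < m' by lra.
have inv2 (z : R) : 1 / 2 <= z -> z^-1 <= 2.
  by move=> z2; rewrite -[2]invrK lef_pV2 ?posrE//; lra.
have b1 : `|m^-1 - 1| <= 2 * (k' * (rho * `|v|)).
  have -> : m^-1 - 1 = m^-1 * (1 - m) by rewrite mulrBr mulr1 mulVf// gt_eqF.
  rewrite normrM gtr0_norm ?invr_gt0// distrC.
  by apply: ler_pM => //; [rewrite invr_ge0 ltW|exact: inv2].
have b2 : `|m^-1 - m'^-1| <= 4 * (k' * (rho * `|v| * `|t - t'|)).
  have -> : m^-1 - m'^-1 = m^-1 * m'^-1 * (m' - m) by field; rewrite !gt_eqF.
  rewrite normrM gtr0_norm ?mulr_gt0 ?invr_gt0// distrC.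
  apply: ler_pM => //; first by rewrite mulr_ge0// invr_ge0 ltW.
  have -> : 4 = 2 * 2 :> R by lra.
  by apply: ler_pM; rewrite ?invr_ge0 ?(ltW m0) ?(ltW m'0)//; exact: inv2.
have b3 : `|p t'| <= `|x| + `|v|.
  rewrite -[p t'](subrK x); apply: le_trans (ler_normD _ _) _.
  rewrite addrC lerD2l; apply: le_trans a5 _.
  by rewrite -[leRHS]mul1r ler_wpM2r.
have b4 : `|p t - p t'| = rho * `|v| * `|t - t'|.
  by rewrite pp normrZ normrM (gtr0_norm rho0); ring.
have -> : m^-1 *: p t - m'^-1 *: p t' - (p t - p t') =
    (m^-1 - 1) *: (p t - p t') + (m^-1 - m'^-1) *: p t'.
  by apply/rowP => i; rewrite !mxE; ring.
apply: le_trans (ler_normD _ _) _; rewrite !normrZ b4.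
pose D := rho * `|t - t'|.
have D0 : 0 <= D by rewrite mulr_ge0// ltW.
apply: le_trans (_ : 2 * (k' * `|v|) * (`|v| * D) +
    4 * (k' * (`|v| * D)) * (`|x| + `|v|) <= _).
  have -> : rho * `|v| * `|t - t'| = `|v| * D by rewrite /D; ring.
  have vD : 0 <= `|v| * D by rewrite mulr_ge0.
  apply: lerD.
    apply: ler_wpM2r => //; apply: le_trans b1 _.
    rewrite ler_pM2l// ler_pM2l// -[leRHS]mul1r ler_wpM2r//.
  apply: ler_pM => //; apply: le_trans b2 _.
  by rewrite /D; lra.
have -> : k * rho * `|t - t'| = k * D by rewrite /D; ring.
apply: le_trans (_ : k' * C * D <= _); last by rewrite ler_wpM2r.
have -> : 2 * (k' * `|v|) * (`|v| * D) + 4 * (k' * (`|v| * D)) * (`|x| + `|v|) =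
   (k' * (C - 1)) * D by rewrite /C; ring.
by rewrite ler_wpM2r// ler_pM2l// gerBl.
Qed.

End gradients.

(** * Polytopes *)

Section orthogonal_spaces.
Variables (R : realType) (d : nat).
Implicit Types (q u w z : 'rV[R]_d).

Let dotp_linear q : linear (dotp q : 'rV[R]_d -> R^o).
Proof. by move=> a x y; rewrite dotpDr dotpZr. Qed.

HB.instance Definition _ q := GRing.isLinear.Build R 'rV[R]_d R^o *:%R
  (dotp q : 'rV[R]_d -> R^o) (dotp_linear q).

Definition orthv q : {vspace 'rV[R]_d} := lker (linfun (dotp q : 'rV[R]_d -> R^o)).

Lemma mem_orthv q z : (z \in orthv q) = (dotp q z == 0).
Proof. by rewrite memv_ker lfunE. Qed.

Lemma dim_orthv q : q != 0 -> \dim (orthv q) = d.-1.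
Proof.
move=> q0; pose f := linfun (dotp q : 'rV[R]_d -> R^o).
have := limg_ker_dim f fullv; rewrite capfv dimvf /dim /= mul1n.
suff -> : \dim (f @: fullv) = 1%N by rewrite addn1 => /(congr1 predn).
apply/eqP; rewrite eqn_leq; apply/andP; split.
  by have := dimvS (subvf (f @: fullv)%VS); rewrite dimvf.
rewrite lt0n dimv_eq0; apply/eqP => f0.
have : f q \in (f @: fullv)%VS by rewrite memv_img// memvf.
by rewrite f0 memv0 lfunE /= dotpxx_eq0; apply/negP.
Qed.

(** A coordinate of [id - projv W] that does not vanish at [z] is a linear form that vanishes on
    [W]; [w] represents it. *)
Lemma vspace_separation (W : {vspace 'rV[R]_d}) z : z \notin W ->
  exists w, (forall u, u \in W -> dotp w u = 0) /\ dotp w z != 0.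
Proof.
move=> zW; pose f := (\1 - projv W)%VF.
have fz : f z != 0.
  apply: contra zW; rewrite add_lfunE opp_lfunE id_lfunE subr_eq0 => /eqP ->.
  exact: memv_proj.
have [i fi] : exists i, f z ord0 i != 0.
  apply/existsP; apply: contraNT fz; rewrite negb_exists => /forallP h.
  by apply/eqP/rowP => i; rewrite mxE; apply/eqP; have := h i; rewrite negbK.
pose w : 'rV[R]_d := \row_j f (delta_mx ord0 j) ord0 i.
have wE u : dotp w u = f u ord0 i.
  rewrite {2}(row_sum_delta u) linear_sum summxE.
  by apply: eq_bigr => j _; rewrite linearZ !mxE mulrC.
exists w; split; last by rewrite wE.
by move=> u uW; rewrite wE add_lfunE opp_lfunE id_lfunE projv_id// subrr mxE.
Qed.

End orthogonal_spaces.

Section convex_hulls.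
Variables (R : realType) (d : nat).
Implicit Types (K : set 'rV[R]_d) (s : seq 'rV[R]_d).

Lemma convex_hull_le s (p : 'rV[R]_d) (c : R) :
  (forall v, v \in s -> dotp p v <= c) ->
  forall y, convex_hull [set` s] y -> dotp p y <= c.
Proof.
move=> h y hy; suff : [set z | dotp p z <= c] y by [].
apply: hy; split => //; apply/convex_setP => u v t t0 t1 /= pu pv.
rewrite dotpDr !dotpZr.
have := ler_wpM2l t0 pu; have := @ler_wpM2l _ (1 - t) _ _ _ pv.
by rewrite subr_ge0 => /(_ t1); lra.
Qed.

Lemma sub_convex_hull s v : v \in s -> convex_hull [set` s] v.
Proof. by move=> vs B [_]; apply. Qed.

Lemma convex_hull_convex (A : set 'rV[R]_d) : convex_set (convex_hull A).
Proof.
apply/convex_setP => x y t t0 t1 hx hy B BA.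
by apply: (convex_setP B).1 => //; [exact: BA.1|exact: hx|exact: hy].
Qed.

Lemma convex_hull_sub (A K : set 'rV[R]_d) : convex_set K -> A `<=` K ->
  convex_hull A `<=` K.
Proof. by move=> cK AK x; apply. Qed.

End convex_hulls.

(** Tight constraints are unaffected by the step, and the finitely many slack ones leave room for
    it. It serves to tilt a supporting functional while staying below 1 on the generators of a
    polytope. *)
Lemma common_step (R : realType) (T : eqType) (a b : T -> R) (s : seq T) :
  (forall v, v \in s -> a v <= 1) ->
  (forall v, v \in s -> a v = 1 -> b v = 0) ->
  exists2 t, 0 < t & forall v, v \in s -> a v + t * b v <= 1.
Proof.
move=> ha hb.
(* Admitting all smaller steps lets the induction take a minimum. *)
suff [t t0 ht] : exists2 t, 0 < t & forall t', 0 <= t' -> t' <= t ->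
    forall v, v \in s -> a v + t' * b v <= 1.
  by exists t => //; apply: ht => //; exact: ltW.
elim: s ha hb => [_ _|v s IH ha hb]; first by exists 1.
have [v' v's|v' v's|t t0 ht] := IH; [exact/ha/mem_behead|exact/hb/mem_behead|].
have := ha v (mem_head v s); rewrite le_eqVlt => /predU1P[av|av].
  exists t => // t' t'0 t't v'; rewrite inE => /predU1P[->|]; last exact: ht.
  by rewrite (hb v (mem_head v s) av) mulr0 addr0 av.
have b1 : 0 < `|b v| + 1 by rewrite ltr_wpDl.
exists (Num.min t ((1 - a v) / (`|b v| + 1))).
  by rewrite lt_min t0 divr_gt0// subr_gt0.
move=> t' t'0; rewrite le_min => /andP[t't t'b] v'.
rewrite inE => /predU1P[->|]; last exact: ht.
rewrite ler_pdivlMr// in t'b.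
have : t' * b v <= t' * (`|b v| + 1).
  by apply: ler_wpM2l => //; have := ler_norm (b v); lra.
lra.
Qed.

(* For convex [F] the multiples [a (x - y)] of differences already form a linear
   subspace, so they fill the direction of the affine hull of [F]. *)
Lemma convex_difference_space (R : realType) (d : nat) (F : set 'rV[R]_d) :
  convex_set F -> F !=set0 -> exists U : {vspace 'rV[R]_d},
    (forall w, w \in U -> exists a x y, [/\ 0 <= a, F x, F y & w = a *: (x - y)]) /\
    (forall x y, F x -> F y -> x - y \in U).
Proof.
move=> cF [x0 Fx0].
pose D (w : 'rV[R]_d) := exists a x y, [/\ 0 <= a, F x, F y & w = a *: (x - y)].
have D0 : D 0 by exists 0, x0, x0; rewrite scale0r.
have DD w w' : D w -> D w' -> D (w + w').
  move=> [a [x [y [a0 Fx Fy ->]]]] [b [x' [y' [b0 Fx' Fy' ->]]]].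
  have [ab0|abn] := eqVneq (a + b) 0.
    have -> : a = 0 by lra.
    have -> : b = 0 by lra.
    by rewrite !scale0r addr0.
  have ab : 0 < a + b by rewrite lt_def abn addr_ge0.
  pose t := a / (a + b).
  have t0 : 0 <= t by rewrite divr_ge0// ltW.
  have t1 : t <= 1 by rewrite ler_pdivrMr// mul1r lerDl.
  exists (a + b), (t *: x + (1 - t) *: x'), (t *: y + (1 - t) *: y'); split.
  - exact: ltW.
  - exact: (convex_setP F).1.
  - exact: (convex_setP F).1.
  have at_ : (a + b) * t = a by rewrite /t mulrC divfK.
  have bt_ : (a + b) * (1 - t) = b by rewrite mulrBr mulr1 at_; lra.
  transitivity (((a + b) * t) *: (x - y) + ((a + b) * (1 - t)) *: (x' - y')).
    by rewrite at_ bt_.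
  by apply/rowP => i; rewrite !mxE; ring.
have DZ a w : D w -> D (a *: w).
  move=> [b [x [y [b0 Fx Fy ->]]]]; have [a0|a0] := leP 0 a.
    by exists (a * b), x, y; rewrite scalerA mulr_ge0.
  exists (- a * b), y, x; split => //; first by rewrite mulr_ge0// oppr_ge0 ltW.
  by rewrite scalerA mulNr scaleNr -scalerN opprB.
pose P := [pred k | `[< exists U : {vspace 'rV[R]_d},
   (forall w, w \in U -> D w) /\ \dim U = k >]].
have exP : exists k, P k.
  exists 0%N; apply/asboolP; exists 0%VS; rewrite dimv0; split => // w.
  by rewrite memv0 => /eqP ->.
have ubP k : P k -> (k <= \dim (fullv : {vspace 'rV[R]_d}))%N.
  by move=> /asboolP[U [_ <-]]; apply: dimvS; exact: subvf.
have [k /asboolP[U [UD dU]] kmax] := ex_maxnP exP ubP.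
exists U; split => // x y Fx Fy.
have Dxy : D (x - y) by exists 1, x, y; rewrite scale1r ler01.
have PU : P (\dim (U + <[x - y]>)).
  apply/asboolP; exists (U + <[x - y]>)%VS; split => // w /memv_addP[u uU [v]].
  by move=> /vlineP[a ->] ->; apply: DD; [exact: UD|exact: DZ].
have /eqP -> : U == (U + <[x - y]>)%VS.
  by rewrite eqEdim addvSl/= dU kmax.
by have := memv_add (mem0v U) (memv_line (x - y)); rewrite add0r.
Qed.

Section facet_normals.
Variables (R : realType) (d : nat) (K : set 'rV[R]_d).
Hypothesis cK : convex_set K.

Lemma maximizer_boundary u x : u != 0 -> K x ->
  (forall y, K y -> dotp u y <= dotp u x) -> boundary K x.
Proof.
move=> u0 Kx ux; split; first exact: subset_closure.
move=> /nbhs_ballP[e /= e0 eK].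
have nu : 0 < `|u| by rewrite normr_gt0.
pose s := e / 2 / `|u|.
have s0 : 0 < s by rewrite !divr_gt0.
have /ux : K (x + s *: u).
  apply: eK; rewrite -ball_normE /= opprD addrA subrr sub0r normrN normrZ.
  by rewrite (gtr0_norm s0) /s divfK ?gt_eqF//; lra.
rewrite dotpDr dotpZr gerDl; apply/negP; rewrite -ltNge.
by rewrite mulr_gt0// dotpxx_gt0.
Qed.

Lemma enorm1_neq0 (u : 'rV[R]_d) : enorm u = 1 -> u != 0.
Proof.
by move=> /eqP; rewrite enorm_eq1; apply: contraTneq => ->; rewrite dotp0l eq_sym oner_eq0.
Qed.

(** A facet contains a segment in every direction orthogonal to its normal, so the curves can be
    exact segments with zero error. *)
Lemma facet_normal_almost_flat u : facet_normals K u -> almost_flat (boundary K) u.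
Proof.
move=> [u1 [F [[[p [c [pc FE]]] [F0 [V [dV FV Vmin]]]] uF]]].
have u0 := enorm1_neq0 u1.
have FK x : F x -> K x by rewrite FE => -[].
have Fp x : F x -> dotp p x = c by rewrite FE => -[].
have cF : convex_set F.
  apply/convex_setP => x y t t0 t1 Fx Fy; rewrite FE; split.
    by apply: (convex_setP K).1 => //; exact: FK.
  by rewrite /= dotpDr !dotpZr !Fp//; ring.
(* The functional [p] cutting out [F] is not assumed parallel to [u]; being maximal on all of [F]
   makes [u] constant there, and a dimension count then identifies [V] with the complement of
   [u]. *)
have Fu x y : F x -> F y -> dotp u (x - y) = 0.
  move=> Fx Fy; apply/eqP; rewrite dotpBr subr_eq0 eq_le.
  by apply/andP; split; apply: uF => //; exact: FK.
have VE : V = orthv u.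
  apply/eqP; rewrite eqEdim dim_orthv// dV leqnn andbT.
  by apply: Vmin => x y Fx Fy; rewrite mem_orthv Fu.
have [U [UD FU]] := convex_difference_space cF F0.
apply: almost_flatI => v k uv k0.
have vU : v \in U by apply: (subvP (Vmin U FU)); rewrite VE mem_orthv uv.
have [a [x [y [a0 Fx Fy vE]]]] := UD v vU.
have FB z : F z -> boundary K z.
  by move=> Fz; apply: (maximizer_boundary u0 (FK z Fz)) => w; exact: uF.
have [az|an] := eqVneq a 0.
  exists 1, (fun=> x); split => // [t _|t t' _ _]; first exact: FB.
  by rewrite vE az scale0r scaler0 subrr subr0 normr0 mulr1 mulr_ge0// ltW.
have ap : 0 < a by rewrite lt_def an.
exists a^-1, (fun t => t *: x + (1 - t) *: y); split.
- by rewrite invr_gt0.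
- move=> t; rewrite in_itv/= => /andP[t0 t1]; apply: FB.
  exact: (convex_setP F).1.
move=> t t' _ _; rewrite vE scalerA mulfVK//.
have -> : t *: x + (1 - t) *: y - (t' *: x + (1 - t') *: y) - (t - t') *: (x - y) = 0.
  by apply/rowP => i; rewrite !mxE; ring.
by rewrite normr0 !mulr_ge0// ?invr_ge0 ltW.
Qed.

End facet_normals.

(** * Bounded polyhedra as convex hulls of their vertices *)

Section polyhedron.
Variables (R : realType) (d : nat) (I : finType) (p : I -> 'rV[R]_d) (M : R).
Local Notation K := [set y : 'rV[R]_d | forall i, dotp (p i) y <= 1].
Hypothesis boundK : forall y, K y -> `|y| <= M.

Definition active (y : 'rV[R]_d) : {set I} := finset (fun i => dotp (p i) y == 1).

(** An algebraic form of extreme points: no line through [y] keeps every active constraint tight. In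
    this form the active set determines the vertex, so there are finitely many. *)
Definition is_vertex (y : 'rV[R]_d) : Prop := K y /\
  forall w, (forall i, i \in active y -> dotp (p i) w = 0) -> w = 0.

(** The point moves along [w] until the first new constraint becomes tight. One is met because
    otherwise the whole ray would lie in the bounded set; active constraints stay tight. *)
Lemma move_to_facet y w : K y -> w != 0 ->
  (forall i, i \in active y -> dotp (p i) w = 0) ->
  exists2 t, 0 < t & K (y + t *: w) /\ (#|active y| < #|active (y + t *: w)|)%N.
Proof.
move=> Ky w0 hw.
have [i0 i0w] : exists i, 0 < dotp (p i) w.
  apply: contrapT => none.
  have M0 : 0 <= M by apply: le_trans (normr_ge0 _) (boundK Ky).
  have nw : 0 < `|w| by rewrite normr_gt0.
  pose t := (M + M + 1) / `|w|.
  have t0 : 0 < t by rewrite divr_gt0//; lra.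
  have : K (y + t *: w).
    move=> i; rewrite dotpDr dotpZr; apply: le_trans (Ky i).
    rewrite gerDl pmulr_rle0// leNgt; apply/negP => iw; apply: none; by exists i.
  move=> /boundK h.
  have : `|t *: w| <= M + M.
    have -> : t *: w = y + t *: w - y by rewrite addrAC subrr add0r.
    by apply: le_trans (ler_normB _ _) _; apply: lerD => //; exact: boundK.
  by rewrite normrZ (gtr0_norm t0) /t divfK ?gt_eqF//; lra.
pose T i := (1 - dotp (p i) y) / dotp (p i) w.
pose j := [arg min_(i < i0 | (0 < dotp (p i) w)%R) T i]%O.
have [jw jmin] : 0 < dotp (p j) w /\ forall i, 0 < dotp (p i) w -> T j <= T i.
  by rewrite /j; case: arg_minP.
have jn : j \notin active y.
  by apply/negP => /hw jw0; rewrite jw0 ltxx in jw.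
have tj : 0 < T j.
  rewrite divr_gt0// subr_gt0 lt_neqAle Ky andbT.
  by move: jn; rewrite inE.
exists (T j) => //; split.
  move=> i; rewrite dotpDr dotpZr; have [iw|iw] := leP (dotp (p i) w) 0.
    by apply: le_trans (Ky i); rewrite gerDl pmulr_rle0.
  by have := jmin i iw; rewrite {2}/T ler_pdivlMr// lerBrDl.
apply: proper_card; apply/properP; split.
  apply/fintype.subsetP => i ia; rewrite inE dotpDr dotpZr hw// mulr0 addr0.
  by move: ia; rewrite inE.
exists j => //; rewrite inE dotpDr dotpZr /T divfK; last by rewrite gt_eqF.
by rewrite addrC subrK.
Qed.

(** Induction on the number of inactive constraints: a point that is not a vertex lies between two
    points, reached along [w] and [- w], with more active constraints. *)
Lemma bounded_polyhedron_polytope : is_polytope K.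
Proof.
have K0 : K 0 by move=> i; rewrite dotp0r.
have cK : convex_set K.
  apply/convex_setP => x y t t0 t1 Kx Ky i; rewrite dotpDr !dotpZr.
  have := ler_wpM2l t0 (Kx i); have := @ler_wpM2l _ (1 - t) _ _ _ (Ky i).
  by rewrite subr_ge0 => /(_ t1); lra.
(* Generators are indexed by sets of constraints; a set that is the active set of no vertex gets the
   default 0, which lies in [K]. *)
have ex (A : {set I}) : exists v, K v /\ forall y, is_vertex y -> active y = A -> y = v.
  have [[v [[Kv hv] vA]]|none] := EM (exists v, is_vertex v /\ active v = A); last first.
    by exists 0; split => // y vy yA; exfalso; apply: none; exists y.
  exists v; split => // y [Ky hy] yA; apply/eqP; rewrite -subr_eq0; apply/eqP.
  apply: hv => i; rewrite vA => iA; rewrite dotpBr.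
  have := iA; rewrite -{1}vA inE => /eqP ->.
  by have := iA; rewrite -{1}yA inE => /eqP ->; rewrite subrr.
have [f hf] := choice ex.
exists [seq f A | A <- enum {set I}].
apply/seteqP; split; last first.
  apply: convex_hull_sub => // _ /= /mapP[A _ ->]; exact: (hf A).1.
suff h k : forall y, K y -> (#|I| - #|active y| < k)%N ->
    convex_hull [set` [seq f A | A <- enum {set I}]] y.
  by move=> y Ky; apply: (h _.+1 y Ky).
elim: k => // k IH y Ky; rewrite ltnS => yk.
have [vy|nv] := EM (is_vertex y).
  apply: sub_convex_hull; apply/mapP; exists (active y); first by rewrite mem_enum.
  exact: (hf _).2.
have [w [w0 hw]] : exists w, w != 0 /\ forall i, i \in active y -> dotp (p i) w = 0.
  apply: contrapT => none; apply: nv; split => // w hw.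
  by apply/eqP; apply: contraPT isT => w0 _; apply: none; exists w.
have hNw i : i \in active y -> dotp (p i) (- w) = 0.
  by move=> /hw h; rewrite dotpNr h oppr0.
have [t t0 [Kt ht]] := move_to_facet Ky w0 hw.
have [|t' t'0 [Kt' ht']] := move_to_facet Ky _ hNw; first by rewrite oppr_eq0.
have lt_active z : (#|active y| < #|active z|)%N -> (#|I| - #|active z| < k)%N.
  move=> yz; apply: leq_trans yk; apply: ltn_sub2l => //.
  by apply: leq_trans yz _; exact: max_card.
have h1 := IH _ Kt (lt_active _ ht).
have h2 := IH _ Kt' (lt_active _ ht').
have tt : 0 < t + t' by rewrite addr_gt0.
have := (convex_setP _).1 (@convex_hull_convex R d _) _ _ (t' / (t + t')) _ _ h1 h2.
have -> : t' / (t + t') *: (y + t *: w) + (1 - t' / (t + t')) *: (y + t' *: - w) = y.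
  by apply/rowP => i; rewrite !mxE; field; rewrite gt_eqF.
apply; first by rewrite divr_ge0 ?ltW.
by rewrite ler_pdivrMr// mul1r lerDr ltW.
Qed.

End polyhedron.

(** * Gradients of the gauge of a symmetric body and its facets *)

Section symmetric_body.
Variables (R : realType) (d : nat) (K : set 'rV[R]_d) (r M : R).
Hypothesis cK : convex_set K.
Hypothesis closedK : closed K.
Hypothesis symK : forall x, K x -> K (- x).
Hypothesis r0 : 0 < r.
Hypothesis ballK : forall x, `|x| < r -> K x.
Hypothesis boundK : forall x, K x -> `|x| <= M.
Local Notation n := (gauge K).
Implicit Types (q u v w x y z : 'rV[R]_d).

Let nD x y : n (x + y) <= n x + n y.
Proof. exact: gaugeD cK closedK r0 ballK x y. Qed.
Let nZ a x : 0 <= a -> n (a *: x) = a * n x.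
Proof. exact: gaugeZ cK closedK r0 ballK a x. Qed.
Let nN x : n (- x) = n x.
Proof. exact: gaugeN cK closedK symK r0 ballK x. Qed.
Let n_gt0 x : x != 0 -> 0 < n x.
Proof. exact: gauge_gt0 cK closedK r0 ballK boundK x. Qed.
Let nK x : n x <= 1 <-> K x.
Proof. exact: gauge_le1 cK closedK r0 ballK x. Qed.
Let gradK y eta : y != 0 -> 0 < eta ->
  exists2 q, gradient n q & n y - eta <= dotp q y.
Proof.
apply: (@gradient_dense R d n r^-1 _ (gauge_norm r0 ballK) nD nZ n_gt0 y eta).
by rewrite invr_gt0.
Qed.

Let le_gauge p : (forall y, K y -> dotp p y <= 1) -> forall y, dotp p y <= n y.
Proof.
move=> h y; have [->|y0] := eqVneq y 0; first by rewrite dotp0r (gauge_ge0 r0 ballK).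
have ny := n_gt0 y0.
have : K ((n y)^-1 *: y).
  apply/nK; rewrite nZ; last by rewrite invr_ge0 ltW.
  by rewrite mulVf// gt_eqF.
by move=> /h; rewrite dotpZr ler_pdivrMl// mulr1.
Qed.

(* If the face spanned less than [q^perp], the supporting functional [q] could be
   tilted at [x], against differentiability of the gauge there. *)
Lemma gradient_facet_normal (s : seq 'rV[R]_d) q : (2 <= d)%N ->
  K = convex_hull [set` s] -> gradient n q -> facet_normals K ((enorm q)^-1 *: q).
Proof.
move=> d2 Ks gq; have q0 : q != 0 by refine (@gradient_neq0 R d n nD nZ q gq).
have [x x1 dq] := gq.
have qx : dotp q x = 1 by rewrite (strict_diff_eq nD nZ dq).
have qn y : dotp q y <= n y by exact: strict_diff_le dq.
have qK y : K y -> dotp q y <= 1 by move=> /nK; exact: le_trans.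
have eq0 : 0 < enorm q by rewrite sqrtr_gt0 dotpxx_gt0.
split.
  by rewrite enormZ gtr0_norm ?invr_gt0// mulVf// gt_eqF.
exists (K `&` [set y | dotp q y = 1]); split; last first.
  by move=> y z [_ /= qy] Kz; rewrite !dotpZl qy ler_pM2l ?invr_gt0// qK.
have Kx : K x by apply/nK; rewrite x1.
split; first by exists q, 1.
split; first by exists x.
exists (orthv q); split; first exact: dim_orthv.
  by move=> y z [_ /= qy] [_ /= qz]; rewrite mem_orthv dotpBr qy qz subrr.
move=> W hW; apply/subvP => z; rewrite mem_orthv => /eqP qz.
apply: contraT => zW; have [w [wW wz]] := vspace_separation zW.
(* The correction makes the tilt vanish at [x], and also at every generator [v] with [dotp q v = 1],
   because [v - x] lies in [W]. So [q + t *: w'] still supports [K] at [x], which forces [w' = 0]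
   and makes [w] a multiple of [q]. *)
pose w' := w - dotp w x *: q.
have w'x : dotp w' x = 0 by rewrite dotpBl dotpZl qx mulr1 subrr.
have sK v : v \in s -> K v by rewrite Ks; exact: sub_convex_hull.
have [t t0 ht] : exists2 t, 0 < t &
    forall v, v \in s -> dotp q v + t * dotp w' v <= 1.
  apply: common_step => v vs; first exact/qK/sK.
  move=> qv; rewrite dotpBl dotpZl qv mulr1 -dotpBr wW// hW//.
  by split => //; exact: sK.
have pE : q + t *: w' = q.
  apply: (strict_diff_uniq dq); last first.
    by rewrite dotpDl dotpZl w'x mulr0 addr0 qx x1.
  apply: le_gauge => y; rewrite Ks; apply: convex_hull_le => v vs.
  by rewrite dotpDl dotpZl; exact: ht.
have : w' = 0.
  move: pE; rewrite -[RHS]addr0 => /addrI /eqP.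
  by rewrite scaler_eq0 gt_eqF//= => /eqP.
move=> /subr0_eq wE; move: wz; rewrite wE dotpZl qz mulr0 eqxx//.
Qed.

(** The gauge is the supremum of its gradients, so finitely many pairs of them cut out [K] as a
    bounded polyhedron. *)
Lemma gradients_cover_polytope (I : finType) (p : I -> 'rV[R]_d) :
  (forall i, gradient n (p i)) ->
  (forall q, gradient n q -> exists i, q = p i \/ q = - p i) -> is_polytope K.
Proof.
move=> gp cov.
pose p' (ib : I * bool) := if ib.2 then p ib.1 else - p ib.1.
have KE : K = [set y | forall i, dotp (p' i) y <= 1].
  apply/seteqP; split => [y Ky [i b]|y /= hy].
    rewrite /p' /=; case: b.
      by apply: le_trans (gradient_le nD nZ y (gp i)) _; exact/nK.
    rewrite dotpNl -dotpNr; apply: le_trans (gradient_le nD nZ (- y) (gp i)) _.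
    exact/nK/symK.
  apply/nK; have [->|y0] := eqVneq y 0; first by rewrite (gauge0 r0 ballK).
  apply/ler_addgt0Pr => e e0.
  have [q gq qy] := gradK y0 e0.
  have q1 : dotp q y <= 1.
    by have [i [->|->]] := cov q gq; [exact: (hy (i, true))|exact: (hy (i, false))].
  lra.
rewrite KE; apply: (@bounded_polyhedron_polytope _ _ _ _ M) => y hy.
by apply: boundK; rewrite KE.
Qed.

(** If finitely many gradients could not be extended by a new one, they would cover all gradients up
    to sign and [K] would be a polytope. The induction uses families on [nat], which are easy to
    extend. *)
Lemma nonparallel_gradients (N : nat) : ~ is_polytope K ->
  exists q : 'I_N -> 'rV[R]_d, (forall i, gradient n (q i)) /\
    forall i j, i != j -> q i <> q j /\ q i <> - q j.
Proof.
move=> nP.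
suff [q [gq hq]] : exists q : nat -> 'rV[R]_d,
    (forall i, (i < N)%N -> gradient n (q i)) /\
    forall i j, (i < N)%N -> (j < N)%N -> i != j -> q i <> q j /\ q i <> - q j.
  exists q; split => [i|i j ij]; first exact: gq.
  by apply: hq => //; exact: ltn_ord.
elim: N => [|N [q [gq hq]]]; first by exists (fun=> 0).
have [p gp hp] : exists2 p, gradient n p &
    forall i, (i < N)%N -> p <> q i /\ p <> - q i.
  apply: contrapT => none; apply: nP.
  apply: (@gradients_cover_polytope 'I_N q) => [i|p gp]; first exact: gq.
  apply: contrapT => h; apply: none; exists p => // i iN.
  by split => pE; apply: h; exists (Ordinal iN); [left|right].
exists (fun i => if i == N then p else q i); split => [i|i j].
  by rewrite ltnS leq_eqVlt; case: eqVneq => //= _; exact: gq.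
have ltN k : k != N -> (k < N.+1)%N -> (k < N)%N.
  by move=> kN; rewrite ltnS leq_eqVlt (negPf kN).
have [->|iN] := eqVneq i N; have [->|jN] := eqVneq j N.
- by [].
- by move=> _ /(ltN _ jN) jN' _; exact: hp.
- move=> /(ltN _ iN) iN' _ _; have [h1 h2] := hp i iN'; split; first exact: nesym.
  by move=> qE; apply: h2; rewrite qE opprK.
- by move=> /(ltN _ iN) iN' /(ltN _ jN); exact: hq.
Qed.

Section polytope.
Variables (s : seq 'rV[R]_d) (N : nat) (theta : 'I_N -> 'rV[R]_d).
Hypothesis d2 : (2 <= d)%N.
Hypothesis Ks : K = convex_hull [set` s].
Hypothesis normalsE : facet_normals K = [set u | exists i, u = theta i \/ u = - theta i].

Lemma theta_enorm i : enorm (theta i) = 1.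
Proof.
have : facet_normals K (theta i) by rewrite normalsE; exists i; left.
by case.
Qed.

Lemma theta_neq0 i : theta i != 0.
Proof. exact: enorm1_neq0 (theta_enorm i). Qed.

Lemma gradient_theta q : gradient n q -> exists i a, a != 0 /\ q = a *: theta i.
Proof.
move=> gq; have := gradient_facet_normal d2 Ks gq.
have q0 : q != 0 by refine (@gradient_neq0 R d n nD nZ q gq).
have e0 : enorm q != 0 by rewrite gt_eqF// sqrtr_gt0 dotpxx_gt0.
have qE : q = enorm q *: ((enorm q)^-1 *: q) by rewrite scalerA divff// scale1r.
rewrite normalsE => -[i [h|h]]; exists i.
  by exists (enorm q); split => //; rewrite -h.
by exists (- enorm q); rewrite oppr_eq0; split => //; rewrite scaleNr -scalerN -h.
Qed.

(** A gradient exists near any nonzero vector, and it is a multiple of some [theta i]. *)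
Lemma normals_nonempty : (0 < N)%N.
Proof.
have [y y0] : exists y : 'rV[R]_d, y != 0.
  exists (const_mx 1); apply/eqP => /rowP/(_ (Ordinal (ltnW d2))).
  by rewrite !mxE => /eqP; rewrite oner_eq0.
have [q /gradient_theta[i _] _] := gradK y0 ltr01.
exact: leq_ltn_trans (ltn_ord i).
Qed.

(** At a boundary point the gradients have supremum 1. Up to sign they take finitely many values
    there, so some value is exactly 1 in modulus; otherwise a positive gap [g] would contradict a
    gradient of value at least [1 - g / 2]. *)
Lemma boundary_hyperplanes : exists2 c : 'I_N -> R, (forall i, 0 < c i) &
  forall y, boundary K y -> exists i, dotp (theta i) y = c i \/ dotp (theta i) y = - c i.
Proof.
have thI a b i : a *: theta i = b *: theta i -> a = b.
  move=> /eqP; rewrite -subr_eq0 -scalerBl scaler_eq0 subr_eq0.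
  by rewrite (negPf (theta_neq0 i)) orbF => /eqP.
(* Gradients parallel to [theta i] agree up to sign, so their common factor defines [c i]; the value
   1 is a default for indices without such a gradient. *)
have ex i : exists c : R, 0 < c /\
    forall q a, gradient n q -> a != 0 -> q = a *: theta i -> `|a| = c^-1.
  have [[q0 [a0 [gq0 a00 q0E]]]|none] :=
    EM (exists q a, [/\ gradient n q, a != 0 & q = a *: theta i]); last first.
    by exists 1; split => // q a gq a0 qE; exfalso; apply: none; exists q, a.
  exists `|a0|^-1; split; first by rewrite invr_gt0 normr_gt0.
  move=> q a gq an qE; rewrite invrK.
  have qq0 : q = (a / a0) *: q0 by rewrite q0E scalerA divfK.
  have [|] := gradient_parallel nD nZ nN gq0 gq qq0; rewrite q0E qE.
    by move=> /thI ->.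
  by rewrite -scaleNr => /thI ->; rewrite normrN.
have [c hc] := choice ex.
exists c => [i|y By]; first exact: (hc i).1.
have y1 : n y = 1.
  by move: By; rewrite (boundary_gauge cK closedK r0 ballK).
have y0 : y != 0.
  apply/eqP => y0; move: y1; rewrite y0 (gauge0 r0 ballK) => /eqP.
  by rewrite eq_sym oner_eq0.
apply: contrapT => none.
have gap i : 0 < `|1 - `|dotp (theta i) y| / c i|.
  rewrite normr_gt0 subr_eq0 eq_sym; apply/eqP => h; apply: none; exists i.
  have ci := (hc i).1.
  have /eqP : `|dotp (theta i) y| = c i by rewrite -[LHS](divfK (lt0r_neq0 ci)) h mul1r.
  by rewrite eqr_norml => /andP[/orP[/eqP->|/eqP->] _]; [left|right].
have [g g0 hg] := finite_pos_lower_bound gap.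
have g20 : 0 < g / 2 by rewrite divr_gt0.
have [q gq qy] := gradK y0 g20.
have [i [a [an qE]]] := gradient_theta gq.
have ca := (hc i).2 q a gq an qE.
have qy1 := gradient_le nD nZ y gq.
have qNy := gradient_le nD nZ (- y) gq.
rewrite nN dotpNr y1 in qNy; rewrite y1 in qy qy1.
have lq := ler_norm (dotp q y).
have := hg i; rewrite mulrC -ca -normrM -dotpZl -qE.
have aq : `|dotp q y| <= 1 by rewrite ler_norml; apply/andP; split; lra.
have aq0 : 0 <= 1 - `|dotp q y| by rewrite subr_ge0.
by rewrite (ger0_norm aq0); lra.
Qed.

End polytope.

End symmetric_body.

Lemma symmetric_body_ball (R : realType) (d : nat) (K : set 'rV[R]_d) :
  convex_body K -> (forall x, K x -> K (- x)) ->
  exists2 r : R, 0 < r & forall x, `|x| < r -> K x.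
Proof.
move=> [cK _ [x0 /nbhs_ballP[e /= e0 eK]]] symK.
exists (e / 2); first exact: divr_gt0.
move=> x xe; pose h : R := 1 / 2.
(* By symmetry [- x0] is in [K], and [x] is the midpoint of it and a point close to [x0]. *)
have -> : x = h *: (x0 + 2 *: x) + (1 - h) *: (- x0).
  by apply/rowP => i; rewrite !mxE /h; field.
apply: (convex_setP K).1 => //; rewrite /h; [lra|lra| |]; last first.
  by apply: symK; apply: eK; exact: ballxx.
apply: eK; rewrite -ball_normE /= opprD addrA subrr sub0r normrN normrZ.
by rewrite ger0_norm//; lra.
Qed.

Theorem theorem2 (R : realType) (d : nat) (K : set 'rV[R]_d)
    (hd : (2 <= d)%N) (hK : convex_body K) (hsym : zero_symmetric K) :
  (forall (N : nat) (eps : R),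
     is_polytope K -> has_face_directions K N ->
     0 < eps -> eps < 1 / (Num.sqrt 2 * N%:R) ->
     ~ exists mu : probability (borelRV R d) R,
         good eps mu /\ supported_on mu (boundary K)) /\
  ((forall (N : nat) (delta : R),
      is_polytope K -> has_face_directions K N -> 0 < delta ->
      exists mu : probability (borelRV R d) R,
        good (1 / N%:R + delta) mu /\ supported_on mu (boundary K)) /\
   (~ is_polytope K -> forall eps : R, 0 < eps ->
      exists mu : probability (borelRV R d) R,
        good eps mu /\ supported_on mu (boundary K))).
Proof.
have [cK coK _] := hK.
have closedK : closed K by apply: compact_closed coK; exact: norm_hausdorff.
have symK x : K x -> K (- x).
  by move=> Kx; rewrite [K]hsym; exists x.
have [r r0 ballK] := symmetric_body_ball hK symK.
have [M boundK] : exists M, forall x, K x -> `|x| <= M.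
  have [M [_ hM]] := compact_bounded coK.
  by exists (M + 1) => x Kx; apply: hM => //; rewrite ltrDl.
have bE := boundary_gauge cK closedK r0 ballK.
split; [|split].
- move=> N eps [s Ks] [theta [_ nE]] eps0 epsN [mu [gmu smu]].
  have [c c0 cov] := boundary_hyperplanes cK closedK symK r0 ballK boundK hd Ks nE.
  apply: (not_good_on_hyperplanes _ (theta_enorm nE) c0 cov eps0 epsN gmu smu).
  rewrite bE; apply: closed_level_set.
  exact: (gauge_continuous cK closedK r0 ballK).
- move=> N delta [s Ks] [theta [thD nE]] delta0.
  have th0 i : theta i != 0 by exact: (theta_neq0 nE i).
  have N0 := normals_nonempty cK closedK r0 ballK boundK hd Ks nE.
  apply: good_measure_of_almost_flat N0 th0 _ _ delta0 => [i j ij a thE|i].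
    have := theta_enorm nE i; rewrite thE enormZ (theta_enorm nE) mulr1.
    have [a0|a0] := leP 0 a.
      rewrite ger0_norm// => a1; apply: (thD i j ij).1; by rewrite thE a1 scale1r.
    rewrite ltr0_norm// => a1; apply: (thD i j ij).2.
    by rewrite thE -[a]opprK a1 scaleN1r.
  by apply: facet_normal_almost_flat => //; rewrite nE; exists i; left.
move=> nP eps eps0.
have nD := gaugeD cK closedK r0 ballK.
have nZ := gaugeZ cK closedK r0 ballK.
have nN := gaugeN cK closedK symK r0 ballK.
(* Enough nonparallel gradients for [1 / N <= eps / 2]; the other half of [eps] is the [delta] of
   the construction. *)
pose N := (Num.truncn (2 / eps)).+1.
have NR : 0 < N%:R :> R by rewrite ltr0n.
have Neps : 1 / N%:R <= eps / 2.
  rewrite ler_pdivrMr//.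
  by have := ltW (truncnS_gt (2 / eps)); rewrite -/N ler_pdivrMr//; lra.
have [q [gq hq]] := nonparallel_gradients cK closedK symK r0 ballK boundK N nP.
have e20 : 0 < eps / 2 by rewrite divr_gt0.
have [//|i|i j ij a qE|i|mu [[R0 R00 hR] smu]] :=
  @good_measure_of_almost_flat R d (boundary K) N q (eps / 2) _ _ _ _ e20.
- exact: gradient_neq0 nD nZ _ (gq i).
- by have [] := gradient_parallel nD nZ nN (gq j) (gq i) qE; apply hq.
- by rewrite bE; exact: gradient_almost_flat.
exists mu; split => //; exists R0 => // x hx.
by apply: le_trans (hR x hx) _; rewrite lecR; lra.
Qed.
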